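(* Let $f:2^V\to\mathbb{R}_+$, $f(S)=\mathbb{E}_{z\sim P}[\tilde f(S,z)]$, be a monotone submodular set function on a ground set $V=\{1,\dots,n\}$, let $\mathcal{I}$ be the family of independent sets of a matroid on $V$ of rank $r$, let $C=\mathrm{conv}\{1_I: I\in\mathcal{I}\}$ be the matroid polytope with $\|x\|\le D$ for all $x\in C$, let $F$ be the multilinear extension of $f$, and let $\mathrm{OPT}=\max_{x\in C}F(x)$. Consider the Stochastic Continuous Greedy (SCG) method (defined in the context) with averaging parameter $\rho_t=4/(t+8)^{2/3}$ applied to $\max_{x\in C}F(x)$. Then for every $\epsilon>0$, SCG produces, after $T=\mathcal{O}(n^{3/2}/\epsilon^3)$ iterations, a point $x_T\in C$ with $$\mathbb{E}[F(x_T)]\ge(1-1/e)\,\mathrm{OPT}-\epsilon.$$ As a consequence, reaching such a $(1-1/e)\mathrm{OPT}-\epsilon$ solution with SCG requires $\mathcal{O}(n^{5/2}/\epsilon^3)$ evaluations of the function $\tilde f$. Here the constants in $\mathcal{O}(\cdot)$ may depend on $r$, $D$, $m_f=\max_{i}f(\{i\})$ and $\max_{j}\mathbb{E}[\tilde f(\{j\},z)^2]$, but not otherwise on $n$ or $\epsilon$.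
   Context: Notation: $\tilde f:2^V\times\mathcal{Z}\to\mathbb{R}_+$ are stochastic set functions, $z\in\mathcal Z$ has distribution $P$. $f$ is submodular if $f(A)+f(B)\ge f(A\cap B)+f(A\cup B)$ for all $A,B\subseteq V$, and monotone if $A\subseteq B\Rightarrow f(A)\le f(B)$. The multilinear extension of $f$ is $F(x)=\sum_{S\subseteq V}f(S)\prod_{i\in S}x_i\prod_{j\notin S}(1-x_j)$, $x\in[0,1]^n$. $1_I$ is the indicator vector of $I$; $\|\cdot\|$ is the Euclidean norm. SCG method with $T$ iterations: $x_0=d_0=0$; $$d_t=(1-\rho_t)d_{t-1}+\rho_tg_t\quad(t\ge1),\qquad v_t\in\arg\max_{v\in C}d_t^Tv,\qquad x_{t+1}=x_t+\frac1Tv_t\quad(t=0,1,\dots,T-1),$$ where $g_t$ is an unbiased stochastic estimate of $\nabla F(x_t)$, obtained with fresh independent randomness at each step. (Since $d_0=0$, $v_0$ is an arbitrary fixed point of $C$; maximizers are chosen measurably.) The estimate at $x$ is computed as follows: draw $z\sim P$, draw a random set $S\subseteq V$ containing each element $i$ independently with probability $x_i$, and set the $i$-th coordinate of the estimate to $\tilde f(S\cup\{i\},z)-\tilde f(S\setminus\{i\},z)$; this costs order $n$ evaluations of $\tilde f$. Standing property of the stochastic gradient estimate $g$ at any $x\in[0,1]^n$: $\mathbb{E}[\|g-\nabla F(x)\|^2]\le n\max_{j\in\{1,\dots,n\}}\mathbb{E}[\tilde f(\{j\},z)^2]$. *)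

(* Defs.v *)
From HB Require Import structures.
From mathcomp Require Import all_boot all_order all_algebra.
From mathcomp Require Import all_classical all_reals all_analysis.

Set Implicit Arguments.
Unset Strict Implicit.
Unset Printing Implicit Defensive.

Import Order.TTheory GRing.Theory Num.Theory.
Import numFieldNormedType.Exports.

Local Open Scope classical_set_scope.
Local Open Scope ring_scope.

Section SetFunctions.
Context {R : realType} {n : nat}.
Implicit Types (f : {set 'I_n} -> R) (S A B : {set 'I_n}) (x u : 'rV[R]_n).

Definition submodular_setfun f :=
  forall A B, f (A :&: B)%SET + f (A :|: B)%SET <= f A + f B.

Definition monotone_setfun f := forall A B, A \subset B -> f A <= f B.

(* The probability of drawing exactly S when each i is included independently
   with probability x_i. *)
Definition set_prob x S : R :=
  (\prod_(i in S) x ord0 i) * (\prod_(j in ~: S) (1 - x ord0 j)).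

(* Defined on the whole of R^n by the polynomial formula, so that its
   derivatives make sense on the boundary of the cube too. *)
Definition multilinear f x : R := \sum_(S : {set 'I_n}) f S * set_prob x S.

Definition grad (F : 'rV[R]_n -> R) x : 'rV[R]_n :=
  \row_(i < n) 'D_(delta_mx ord0 i) F x.

(* MathComp's norm on 'rV is the sup norm, hence these two. *)
Definition dotp u x : R := \sum_(i < n) u ord0 i * x ord0 i.
Definition enorm x : R := Num.sqrt (\sum_(i < n) x ord0 i ^+ 2).

Definition in_cube x := forall i, 0 <= x ord0 i <= 1.

Definition maximum_of (E : set R) (m : R) := E m /\ ubound E m.

Definition argmax (C : set 'rV[R]_n) u : set 'rV[R]_n :=
  [set v | C v /\ forall w, C w -> dotp u w <= dotp u v].

End SetFunctions.

Section Matroids.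
Context {n : nat}.

Record matroid (I : {set {set 'I_n}}) : Prop := Matroid {
  matroid0 : finset.set0 \in I ;
  matroid_sub : forall A B : {set 'I_n}, A \subset B -> B \in I -> A \in I ;
  matroid_aug : forall A B : {set 'I_n}, A \in I -> B \in I ->
    (#|A| < #|B|)%N -> exists2 i, i \in B :\: A & i |: A \in I }.

Definition matroid_rank (I : {set {set 'I_n}}) : nat := \max_(A in I) #|A|.

Definition indicator (R : realType) (A : {set 'I_n}) : 'rV[R]_n :=
  \row_(i < n) (i \in A)%:R.

Definition matroid_polytope (R : realType) (I : {set {set 'I_n}}) :
    set 'rV[R]_n :=
  [set x : 'rV[R]_n | exists lam : {set 'I_n} -> R,
    [/\ forall A, A \in I -> 0 <= lam A,
        \sum_(A in I) lam A = 1
      & x = \sum_(A in I) lam A *: indicator R A]].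

End Matroids.

Arguments matroid_polytope {n} R I.

Section GradientEstimate.
Context {R : realType} {n : nat} {Z : Type}.
Variable ft : {set 'I_n} -> Z -> R.

(* Computations that evaluate ft return their value paired with the number of
   evaluations of ft performed. *)
Definition query (S : {set 'I_n}) (z : Z) : R * nat := (ft S z, 1%N).

Definition coord_run (S : {set 'I_n}) (z : Z) (i : 'I_n) : R * nat :=
  let: (a, p) := query (i |: S)%SET z in
  let: (b, q) := query (S :\ i)%SET z in
  (a - b, (p + q)%N).

Definition grad_est (S : {set 'I_n}) (z : Z) : 'rV[R]_n :=
  \row_(i < n) (coord_run S z i).1.

Definition grad_cost (S : {set 'I_n}) (z : Z) : nat :=
  (\sum_(i < n) (coord_run S z i).2)%N.

End GradientEstimate.

Definition rho (R : realType) (t : nat) : R :=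
  4 / ((t + 8)%:R `^ (2 / 3)).

Section SCG.
Context {R : realType} {n : nat}.
Context {dZ : measure_display} {Z : measurableType dZ}.
Context {dO : measure_display} {O : measurableType dO}.

(* The events of O determined by the samples (z_s, S_s), 1 <= s <= t; for
   t = 0 these are only the empty set and the whole space. *)
Definition history (z : nat -> O -> Z) (S : nat -> O -> {set 'I_n}) (t : nat) :
    set (set O) :=
  <<s [set E | exists2 s, (1 <= s <= t)%N &
        (exists2 B, measurable B & E = z s @^-1` B) \/
        (exists A, E = S s @^-1` [set A])] >>.

(* A run of SCG with T iterations on the feasible set C, realised on the
   probability space (O, Pr).  No gradient is sampled at t = 0 since d_0 = 0.
   [scg_fresh] is "fresh randomness": given the samples drawn before step t,
   z_t and S_t are independent, z_t has law P and S_t contains each i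
   independently with probability (x_t)_i.
   [scg_adapted] is the measurability of the choice of the maximizers; for
   t = 0 it says that v_0 is a fixed point of C. *)
Record SCG (C : set 'rV[R]_n) (ft : {set 'I_n} -> Z -> R)
    (P : probability Z R) (Pr : probability O R) (T : nat)
    (z : nat -> O -> Z) (S : nat -> O -> {set 'I_n})
    (x d v : nat -> O -> 'rV[R]_n) : Prop := IsSCG {
  scg_z_measurable : forall t, (1 <= t < T)%N -> measurable_fun setT (z t) ;
  scg_S_measurable : forall t A, (1 <= t < T)%N ->
    measurable (S t @^-1` [set A]) ;
  scg_fresh : forall t (E : set O) (B : set Z) (A : {set 'I_n}),
    (1 <= t < T)%N -> history z S t.-1 E -> measurable B ->
    Pr (E `&` z t @^-1` B `&` S t @^-1` [set A]) =
      (P B * \int[Pr]_(w in E) (set_prob (x t w) A)%:E)%E ;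
  scg_x0 : forall w, x 0%N w = 0 ;
  scg_d0 : forall w, d 0%N w = 0 ;
  scg_d : forall t w, (1 <= t < T)%N ->
    d t w = (1 - rho R t) *: d t.-1 w + rho R t *: grad_est ft (S t w) (z t w) ;
  scg_v : forall t w, (t < T)%N -> argmax C (d t w) (v t w) ;
  scg_adapted : forall t i (B : set R), (t < T)%N -> measurable B ->
    history z S t ((fun w => v t w ord0 i) @^-1` B) ;
  scg_x : forall t w, (t < T)%N -> x t.+1 w = x t w + T%:R^-1 *: v t w }.

Definition scg_evals (ft : {set 'I_n} -> Z -> R) (T : nat)
    (z : nat -> O -> Z) (S : nat -> O -> {set 'I_n}) (w : O) : nat :=
  (\sum_(1 <= t < T) grad_cost ft (S t w) (z t w))%N.

End SCG.

(* Main.v *)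
Require Import Defs.
From HB Require Import structures.
From mathcomp Require Import all_boot all_order all_algebra.
From mathcomp Require Import all_classical all_reals all_analysis.
From mathcomp Require Import measurable_realfun.
From mathcomp Require Import ring lra zify.

Import Order.TTheory GRing.Theory Num.Theory.
Import numFieldNormedType.Exports.

Set Implicit Arguments.
Unset Strict Implicit.
Unset Printing Implicit Defensive.

Local Open Scope classical_set_scope.
Local Open Scope ring_scope.

(** The multilinear extension [F] of a monotone submodular function is monotone,
    and concave along nonnegative directions, so that
    [F v - F x <= <grad F x, v>] for all [x, v] in the cube ([multilinear_gap]).
    With exact gradients, each of the [T] steps of length [1/T] would therefore
    close the fraction [1/T] of the gap to [OPT], up to a curvature term of order
    [1/T^2], and the remaining gap would be [(1 - 1/T)^T OPT <= OPT / e].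

    The algorithm maximizes over [d_t] instead of the gradient, which costs at
    most [2 D |grad F x_t - d_t| / T] per step, where [D] bounds the norms of the
    feasible points.  By the inequality between the
    arithmetic and geometric means this is at most
    [(D / T) (|grad F x_t - d_t|^2 / c_t + c_t)] for any scale [c_t > 0], so only
    the expected squared errors matter ([iterate_gap], [expected_gap]).

    These errors obey a recursion ([gradient_error_step]).  Given the samples
    drawn before step [t], the estimate [g_t] is unbiased with variance at most
    [n M], and averaging damps its variance by [rho_t^2]; the gradient itself
    drifts by at most [m r / T] per coordinate in one step.  With
    [rho_t = 4 / (t+8)^(2/3)] the recursion yields
    [E |grad F x_t - d_t|^2 <= n Q / (t+8)^(2/3)] ([gradient_error_bound]).
    Taking for [c_t] the square root of this bound and summing gives a total loss
    of order [sqrt n T^(-1/3)], which is below [eps] as soon as [T] is of order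
    [n^(3/2) / eps^3].  An estimate costs [2 n] evaluations, hence the second
    count.

    The probabilistic core is [ge0_integral_fresh]: for a nonnegative function of
    the past and of the fresh sample, the sample can be integrated out first.  All
    error functions being nonnegative, Tonelli's theorem suffices and no
    integrability of the iterates has to be established. *)

(** * The multilinear extension of a set function *)

Section MultilinearExtension.
Context {R : realType} {n : nat}.
Implicit Types (g f : {set 'I_n} -> R) (x y v : 'rV[R]_n) (S A B : {set 'I_n}).

Definition marginal g (i : 'I_n) S : R := g (i |: S)%SET - g (S :\ i)%SET.

(** [set_prob] as a single product over all coordinates, the form in which
    products distribute over sums of subsets. *)
Definition coord_prob x S i : R := if i \in S then x ord0 i else 1 - x ord0 i.

Lemma set_probE x S : set_prob x S = \prod_i coord_prob x S i.
Proof.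
rewrite /set_prob [RHS](bigID (mem S)) /=; congr (_ * _).
  by apply: eq_bigr => i iS; rewrite /coord_prob iS.
rewrite (eq_bigl (fun i => i \notin S)); last by move=> i; rewrite !inE.
by apply: eq_bigr => i iS; rewrite /coord_prob (negbTE iS).
Qed.

(** Condition on whether [i] is drawn: the sets containing [i] are the
    [i |: S] with [i] not in [S]. *)
Lemma multilinear_split g x i : multilinear g x =
  \sum_(S : {set 'I_n} | i \notin S) (\prod_(j | j != i) coord_prob x S j) *
     (x ord0 i * g (i |: S)%SET + (1 - x ord0 i) * g S).
Proof.
rewrite /multilinear (bigID (fun S : {set 'I_n} => i \in S)) /=.
rewrite (reindex_onto (fun S => i |: S)%SET (fun S => S :\ i)%SET) /=; last first.
  by move=> S iS; rewrite finset.setD1K.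
rewrite (eq_bigl (fun S : {set 'I_n} => i \notin S)); last first.
  move=> S; rewrite finset.setU11 /=; apply/eqP/idP => [<-|iS]; first by rewrite !inE eqxx.
  by rewrite finset.setU1K.
rewrite -big_split /=; apply: eq_bigr => S iS.
rewrite !set_probE !(bigD1 i (P := predT)) //= {1 3}/coord_prob finset.setU11 (negbTE iS).
rewrite (eq_bigr (fun j => coord_prob x S j)); first by ring.
by move=> j ji; rewrite /coord_prob !inE (negbTE ji).
Qed.

(** Each term of [multilinear_split] is affine in [x_i].  A marginal at [i] does
    not see whether [i] belongs to its argument, so the slope does not depend on
    [x_i]. *)
Lemma multilinear_step g x y i : (forall j, j != i -> y ord0 j = x ord0 j) ->
  multilinear g y - multilinear g x =
  (y ord0 i - x ord0 i) * multilinear (marginal g i) x.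
Proof.
move=> xy; rewrite !(multilinear_split _ _ i) mulr_sumr -sumrB.
apply: eq_bigr => S iS.
rewrite (eq_bigr (fun j => coord_prob x S j)); last first.
  by move=> j ji; rewrite /coord_prob xy.
rewrite /marginal finset.setUA finset.setUid finset.setU1K //.
have -> : (S :\ i = S)%SET.
  by apply/setP => j; rewrite !inE; case: eqVneq => [->|//]; rewrite (negbTE iS).
ring.
Qed.

Lemma set_prob_sum x : \sum_S set_prob x S = 1.
Proof.
under eq_bigr do rewrite set_probE.
transitivity (\prod_(i < n) (x ord0 i + (1 - x ord0 i))).
  by rewrite bigA_distr; apply: eq_big => [S|S _]; rewrite ?inE.
by rewrite big1 // => i _; ring.
Qed.

Lemma set_prob_ge0 x S : in_cube x -> 0 <= set_prob x S.
Proof.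
move=> xc; rewrite set_probE; apply: prodr_ge0 => i _.
by rewrite /coord_prob; have /andP[x0 x1] := xc i; case: ifP; rewrite ?subr_ge0.
Qed.

Lemma ler_multilinear g f x : in_cube x -> (forall S, g S <= f S) ->
  multilinear g x <= multilinear f x.
Proof.
by move=> xc gf; apply: ler_sum => S _; rewrite ler_wpM2r // set_prob_ge0.
Qed.

Lemma multilinear_cst (c : R) x : multilinear (fun=> c) x = c.
Proof. by rewrite /multilinear -mulr_sumr set_prob_sum mulr1. Qed.

Lemma multilinearN g x : multilinear (fun S => - g S) x = - multilinear g x.
Proof. by rewrite /multilinear -sumrN; apply: eq_bigr => S _; rewrite mulNr. Qed.

Lemma multilinear0 g : multilinear g 0 = g finset.set0.
Proof.
rewrite /multilinear (bigD1 finset.set0) //= big1 ?addr0.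
  rewrite set_probE big1 ?mulr1 // => i _.
  by rewrite /coord_prob inE mxE subr0.
move=> S /set0Pn[i iS]; rewrite set_probE (bigD1 i) //= /coord_prob iS mxE.
by rewrite mul0r mulr0.
Qed.

(** The corner points of the staircase from [x] to [y] that moves the
    coordinates in increasing order. *)
Definition path_point x y (k : nat) : 'rV[R]_n :=
  \row_j (if (j < k)%N then y ord0 j else x ord0 j).

(** Along the staircase every step is exactly affine.  This finite identity
    replaces the fundamental theorem of calculus: monotonicity, Lipschitz bounds
    and tangent inequalities for the extension all follow from bounds on the
    discrete derivatives. *)
Lemma multilinear_telescope g x y : multilinear g y - multilinear g x =
  \sum_(k < n) (y ord0 k - x ord0 k) * multilinear (marginal g k) (path_point x y k).
Proof.
have -> : multilinear g y = multilinear g (path_point x y n).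
  by congr multilinear; apply/rowP => j; rewrite mxE ltn_ord.
have -> : multilinear g x = multilinear g (path_point x y 0).
  by congr multilinear; apply/rowP => j; rewrite mxE ltn0.
rewrite -(telescope_sumr (fun k => multilinear g (path_point x y k))) // big_mkord.
apply: eq_bigr => k _.
rewrite (@multilinear_step g (path_point x y k) _ k); last first.
  move=> j jk; rewrite !mxE ltnS leq_eqVlt.
  by case: eqVneq => //= e; case/eqP: jk; apply: val_inj.
by rewrite !mxE ltnSn ltnn.
Qed.

Lemma path_point_cube x y k : in_cube x -> in_cube y -> in_cube (path_point x y k).
Proof. by move=> xc yc j; rewrite mxE; case: ifP. Qed.

Lemma multilinear_homo g x y : in_cube x -> in_cube y ->
  (forall j, x ord0 j <= y ord0 j) ->
  monotone_setfun g -> multilinear g x <= multilinear g y.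
Proof.
move=> xc yc xy gm; rewrite -subr_ge0 multilinear_telescope.
apply: sumr_ge0 => k _; apply: mulr_ge0; first by rewrite subr_ge0.
rewrite -(multilinear_cst 0 (path_point x y k)).
apply: ler_multilinear; first exact: path_point_cube.
move=> S; rewrite subr_ge0; apply: gm.
by apply/fintype.subsetP => j; rewrite !inE => /andP[_ ->]; rewrite orbT.
Qed.

Lemma multilinear_lipschitz g (c : R) x y : in_cube x -> in_cube y ->
  (forall j, x ord0 j <= y ord0 j) ->
  (forall i S, marginal g i S <= c) ->
  multilinear g y - multilinear g x <= c * \sum_j (y ord0 j - x ord0 j).
Proof.
move=> xc yc xy gm; rewrite multilinear_telescope mulr_sumr.
apply: ler_sum => k _; rewrite [leRHS]mulrC ler_wpM2l ?subr_ge0 //.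
rewrite -(multilinear_cst c (path_point x y k)).
by apply: ler_multilinear => //; exact: path_point_cube.
Qed.

(** The difference quotients in direction [i] are constant, by affinity. *)
Lemma grad_multilinear g x i : grad (multilinear g) x ord0 i = multilinear (marginal g i) x.
Proof.
rewrite mxE /derive; apply: cvg_lim => //.
apply: cvg_near_cst; near=> h.
have h0 : h != 0 by near: h; exact: nbhs_dnbhs_neq.
rewrite (@multilinear_step g x _ i).
  rewrite !mxE !eqxx /= mulr1 -[_ *: _]/(_ * _).
  by field.
by move=> j ji; rewrite !mxE eqxx (negbTE ji) mulr0 add0r.
Unshelve. all: by end_near.
Qed.

End MultilinearExtension.

(** * Monotone submodular functions *)

Section MonotoneSubmodular.
Context {R : realType} {n : nat}.
Variables (f : {set 'I_n} -> R) (m : R).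
Hypotheses (f_ge0 : forall A, 0 <= f A) (f_mono : monotone_setfun f)
  (f_submod : submodular_setfun f) (f_single : forall i, f [set i]%SET <= m).
Implicit Types (x y v : 'rV[R]_n) (S A B : {set 'I_n}).
Local Notation F := (multilinear f).

Lemma marginal_ge0 i S : 0 <= marginal f i S.
Proof.
rewrite subr_ge0; apply: f_mono.
by apply/fintype.subsetP => j; rewrite !inE => /andP[_ ->]; rewrite orbT.
Qed.

(** Diminishing returns: submodularity applied to [i |: A] and [B :\ i]. *)
Lemma marginal_antitone i A B : A \subset B -> marginal f i B <= marginal f i A.
Proof.
move=> /fintype.subsetP AB; have := f_submod (i |: A)%SET (B :\ i)%SET.
have -> : ((i |: A) :&: (B :\ i) = A :\ i)%SET.
  apply/setP => j; rewrite !inE; case: eqVneq => //= _.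
  by case jA: (j \in A) => //=; rewrite AB.
have -> : ((i |: A) :|: (B :\ i) = i |: B)%SET.
  apply/setP => j; rewrite !inE; case: eqVneq => //= _.
  by case jA: (j \in A) => //=; rewrite AB.
rewrite /marginal; lra.
Qed.

Lemma marginal_le i S : marginal f i S <= m.
Proof.
have /le_trans -> // : marginal f i S <= marginal f i finset.set0.
  by apply: marginal_antitone; exact: finset.sub0set.
rewrite /marginal finset.setU0 lerBlDr (le_trans (f_single i)) //.
by rewrite lerDl.
Qed.

Lemma grad_ge0 x i : in_cube x -> 0 <= grad F x ord0 i.
Proof.
move=> xc; rewrite grad_multilinear -[leLHS](multilinear_cst 0 x).
by apply: ler_multilinear => // S; exact: marginal_ge0.
Qed.

Lemma grad_le x i : in_cube x -> grad F x ord0 i <= m.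
Proof.
move=> xc; rewrite grad_multilinear -[leRHS](multilinear_cst m x).
by apply: ler_multilinear => // S; exact: marginal_le.
Qed.

(** A partial derivative is the extension of a discrete derivative, which
    decreases along inclusions. *)
Lemma grad_antitone x y i : in_cube x -> in_cube y ->
  (forall j, x ord0 j <= y ord0 j) -> grad F y ord0 i <= grad F x ord0 i.
Proof.
move=> xc yc xy; rewrite !grad_multilinear -lerN2 -!multilinearN.
apply: multilinear_homo => // A B AB; rewrite lerN2.
exact: marginal_antitone.
Qed.

(** Second discrete derivatives are differences of two marginals, both of which
    lie in [[0, m]]. *)
Lemma grad_lipschitz x y i : in_cube x -> in_cube y ->
  (forall j, x ord0 j <= y ord0 j) ->
  grad F x ord0 i - grad F y ord0 i <= m * \sum_j (y ord0 j - x ord0 j).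
Proof.
move=> xc yc xy; rewrite !grad_multilinear.
have := @multilinear_lipschitz R n (fun S => - marginal f i S) m x y xc yc xy.
rewrite !multilinearN opprK addrC; apply => j S.
rewrite {1}/marginal; have := marginal_ge0 i (j |: S)%SET.
have := marginal_le i (S :\ j)%SET; lra.
Qed.

Lemma path_point_between x y k j : x ord0 j <= y ord0 j ->
  x ord0 j <= path_point x y k ord0 j <= y ord0 j.
Proof. by move=> xy; rewrite mxE; case: ifP; rewrite xy lexx. Qed.

(** [F] need not be concave, but along nonnegative directions it is: on the staircase
    from [x] up to [y] the slopes lie between their values at [y] and at [x].
    This gives the two tangent inequalities. *)
Lemma multilinear_le_tangent x y : in_cube x -> in_cube y ->
  (forall j, x ord0 j <= y ord0 j) -> F y - F x <= dotp (grad F x) (y - x).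
Proof.
move=> xc yc xy; rewrite multilinear_telescope; apply: ler_sum => k _.
rewrite mulrC [(y - x) _ _]mxE [(- x) _ _]mxE ler_wpM2r ?subr_ge0 // -grad_multilinear.
apply: (@grad_antitone x (path_point x y k) k xc (path_point_cube _ xc yc)) => j.
by case/andP: (@path_point_between x y k j (xy j)).
Qed.

Lemma multilinear_ge_tangent x y : in_cube x -> in_cube y ->
  (forall j, x ord0 j <= y ord0 j) -> dotp (grad F y) (y - x) <= F y - F x.
Proof.
move=> xc yc xy; rewrite multilinear_telescope; apply: ler_sum => k _.
rewrite [leRHS]mulrC [(y - x) _ _]mxE [(- x) _ _]mxE ler_wpM2r ?subr_ge0 // -grad_multilinear.
apply: (@grad_antitone (path_point x y k) y k (path_point_cube _ xc yc) yc) => j.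
by case/andP: (@path_point_between x y k j (xy j)).
Qed.

(** The inequality behind the constant [1 - 1/e]: following the gradient towards
    any [v] gains at least the present gap.  Go through the coordinatewise
    maximum of [x] and [v], which is above [v] in value and above [x] by at most
    [v]. *)
Lemma multilinear_gap x v : in_cube x -> in_cube v ->
  F v - F x <= dotp (grad F x) v.
Proof.
move=> xc vc; pose y : 'rV[R]_n := \row_j Num.max (x ord0 j) (v ord0 j).
have yc : in_cube y.
  by move=> j; rewrite mxE; case: (leP (x ord0 j) (v ord0 j)).
have xy j : x ord0 j <= y ord0 j by rewrite mxE le_max lexx.
have vy j : v ord0 j <= y ord0 j by rewrite mxE le_max lexx orbT.
apply: (@le_trans _ _ (F y - F x)); first by rewrite lerD2r multilinear_homo.
apply: (le_trans (multilinear_le_tangent xc yc xy)).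
apply: ler_sum => i _; rewrite ler_wpM2l ?grad_ge0 // !mxE.
have /andP[x0 x1] := xc i; have /andP[v0 v1] := vc i.
by case: (leP (x ord0 i) (v ord0 i)) => _; lra.
Qed.

(** The gain of a step is at least the slope at its far end, which the Lipschitz
    bound compares with the slope at [x]. *)
Lemma multilinear_progress x v (a s : R) : 0 <= a -> 0 <= m ->
  in_cube x -> in_cube (x + a *: v) -> (forall j, 0 <= v ord0 j) ->
  \sum_j v ord0 j <= s ->
  a * dotp (grad F x) v - m * s ^+ 2 * a ^+ 2 <= F (x + a *: v) - F x.
Proof.
move=> a0 m0 xc yc v0 vs; set y := x + _.
have xy j : x ord0 j <= y ord0 j by rewrite !mxE lerDl mulr_ge0.
apply: le_trans (multilinear_ge_tangent xc yc xy).
have yx : y - x = a *: v by rewrite /y addrC addKr.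
have dist : \sum_j (y ord0 j - x ord0 j) = a * \sum_j v ord0 j.
  by rewrite mulr_sumr; apply: eq_bigr => j _; rewrite !mxE; ring.
have s0 : 0 <= \sum_j v ord0 j by apply: sumr_ge0.
rewrite yx (_ : dotp _ (a *: v) = a * dotp (grad F y) v); last first.
  by rewrite /dotp mulr_sumr; apply: eq_bigr => j _; rewrite !mxE; ring.
have : dotp (grad F x) v - dotp (grad F y) v <= m * s ^+ 2 * a.
  rewrite /dotp -sumrB.
  apply: (@le_trans _ _ (\sum_j (m * (a * s)) * v ord0 j)).
    apply: ler_sum => j _; rewrite -mulrBl ler_wpM2r //.
    apply: (le_trans (grad_lipschitz j xc yc xy)); rewrite dist.
    by rewrite ler_wpM2l // ler_wpM2l.
  rewrite -mulr_sumr (_ : m * s ^+ 2 * a = m * (a * s) * s); last by ring.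
  rewrite ler_wpM2l // !mulr_ge0 //; exact: le_trans vs.
by move=> h; nra.
Qed.

(** Tangent inequality at the origin, where all slopes are at most [m]. *)
Lemma multilinear_le x (s : R) : (0 < n)%N -> in_cube x ->
  \sum_j x ord0 j <= s -> 0 <= m -> F x <= m * (s + 1).
Proof.
move=> n0 xc xs m0.
have c0 : in_cube (0 : 'rV[R]_n) by move=> j; rewrite mxE lexx ler01.
have x0 j : (0 : 'rV[R]_n) ord0 j <= x ord0 j by rewrite mxE; case/andP: (xc j).
have := multilinear_le_tangent c0 xc x0; rewrite subr0 multilinear0.
have : f finset.set0 <= m.
  by apply: le_trans (f_single (Ordinal n0)); apply: f_mono; exact: finset.sub0set.
have : dotp (grad F 0) x <= m * s.
  apply: (@le_trans _ _ (m * \sum_j x ord0 j)); last exact: ler_wpM2l.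
  rewrite mulr_sumr; apply: ler_sum => j _; rewrite ler_wpM2r ?grad_le //.
  by case/andP: (xc j).
lra.
Qed.

End MonotoneSubmodular.

(** * The matroid polytope *)

Section Polytope.
Context {R : realType} {n : nat}.
Variable I : {set {set 'I_n}}.
Implicit Types (x v : 'rV[R]_n).

(** The dilate [c C] of the matroid polytope, which is the case [c = 1].  The
    iterate after [t] of [T] steps lies in the dilate by [t / T], and tracking
    the total weight of the vertices is all the convexity that is needed. *)
Definition dilated_polytope (c : R) : set 'rV[R]_n :=
  [set x | exists lam : {set 'I_n} -> R,
    [/\ forall A, A \in I -> 0 <= lam A,
        \sum_(A in I) lam A = c
      & x = \sum_(A in I) lam A *: indicator R A]].

Lemma dilated_polytope0 : dilated_polytope 0 0.
Proof.
exists (fun=> 0); split => //; first by rewrite big1.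
by rewrite big1 // => A _; rewrite scale0r.
Qed.

Lemma dilated_polytopeD a b x v : dilated_polytope a x -> matroid_polytope R I v ->
  0 <= b -> dilated_polytope (a + b) (x + b *: v).
Proof.
move=> [l [l0 ls ->]] [k [k0 ks ->]] b0; exists (fun A => l A + b * k A); split.
- by move=> A AI; rewrite addr_ge0 ?l0 // mulr_ge0 ?k0.
- by rewrite big_split /= -mulr_sumr ls ks mulr1.
- rewrite scaler_sumr -big_split /=; apply: eq_bigr => A _.
  by rewrite scalerDl scalerA.
Qed.

Lemma dilated_polytope_ge0 c x i : dilated_polytope c x -> 0 <= x ord0 i.
Proof.
move=> [l [l0 ls ->]]; rewrite summxE; apply: sumr_ge0 => A AI.
by rewrite !mxE mulr_ge0 ?l0.
Qed.

Lemma dilated_polytope_le c x i : dilated_polytope c x -> x ord0 i <= c.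
Proof.
move=> [l [l0 <- ->]]; rewrite summxE; apply: ler_sum => A AI.
by rewrite !mxE; have := l0 A AI; case: (i \in A); rewrite /= ?mulr1 ?mulr0.
Qed.

Lemma dilated_polytope_cube c x : c <= 1 -> dilated_polytope c x -> in_cube x.
Proof.
move=> c1 xc i; rewrite (dilated_polytope_ge0 _ xc) /=.
exact: le_trans (dilated_polytope_le _ xc) c1.
Qed.

Lemma polytope_sum_le x : matroid_polytope R I x ->
  \sum_i x ord0 i <= (matroid_rank I)%:R.
Proof.
move=> [l [l0 ls ->]]; under eq_bigr do rewrite summxE.
rewrite exchange_big /=.
apply: (@le_trans _ _ (\sum_(A in I) l A * (matroid_rank I)%:R)); last first.
  by rewrite -mulr_suml ls mul1r.
apply: ler_sum => A AI; under eq_bigr do rewrite !mxE.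
rewrite -mulr_sumr ler_wpM2l ?l0 // -natr_sum ler_nat.
rewrite (eq_bigr (fun i => if i \in A then 1%N else 0%N)); last by move=> i _; case: ifP.
rewrite -big_mkcond sum1_card /matroid_rank.
exact: (@leq_bigmax_cond _ (mem I) (fun A : {set 'I_n} => #|A|) A).
Qed.

Lemma polytope0 : matroid I -> matroid_polytope R I 0.
Proof.
move=> mI; exists (fun A => (A == finset.set0)%:R); split.
- by move=> A _; rewrite ler0n.
- rewrite (bigD1 finset.set0) ?(matroid0 mI) //= eqxx big1 ?addr0 //.
  by move=> A /andP[_ /negbTE ->].
- rewrite big1 // => A _; case: eqVneq => [->|_]; last by rewrite scale0r.
  by apply/rowP => i; rewrite !mxE inE mulr0.
Qed.

End Polytope.

(** * Step sizes and error scales *)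

Section StepSizes.
Context {R : realType}.

(** All step sizes and error scales are expressed through cube roots of naturals,
    which makes the inequalities between them polynomial. *)
Definition cbrt (k : nat) : R := k%:R `^ (1 / 3).

Lemma cbrt_ge0 k : 0 <= cbrt k.
Proof. exact: powR_ge0. Qed.

Lemma cbrtX3 k : cbrt k ^+ 3 = k%:R.
Proof.
rewrite /cbrt -powR_mulrn ?powR_ge0 // -powRrM.
by rewrite (_ : 1 / 3 * 3%:R = 1) ?powRr1 //; field.
Qed.

Lemma cbrtX2 k : k%:R `^ (2 / 3) = cbrt k ^+ 2.
Proof.
rewrite /cbrt -powR_mulrn ?powR_ge0 // -powRrM.
by rewrite (_ : 1 / 3 * 2%:R = 2 / 3) //; field.
Qed.

Lemma cbrt_ge k (a : R) : a ^+ 3 <= k%:R -> a <= cbrt k.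
Proof.
move=> ak; have [a0|/ltW a0] := leP 0 a; last exact: le_trans a0 (cbrt_ge0 k).
by rewrite -(@ler_pXn2r _ 3) ?nnegrE ?cbrt_ge0 // cbrtX3.
Qed.

Lemma cbrt_homo k l : (k <= l)%N -> cbrt k <= cbrt l.
Proof. by move=> kl; apply: cbrt_ge; rewrite cbrtX3 ler_nat. Qed.

Lemma cbrt_ge1 k : (0 < k)%N -> 1 <= cbrt k.
Proof. by move=> k0; apply: cbrt_ge; rewrite expr1n ler1n. Qed.

Lemma cbrt_le k : (0 < k)%N -> cbrt k <= k%:R.
Proof.
move=> k0; rewrite -[leRHS]cbrtX3; have := cbrt_ge1 k0; nra.
Qed.

(** Subadditivity of [t^(2/3)]: compare the cubes of both sides, with
    [(b^3 + 1)^2 <= (b^2 + 1)^3]. *)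
Lemma cbrtS_sqr k : cbrt k.+1 ^+ 2 <= cbrt k ^+ 2 + 1.
Proof.
have k0 := cbrt_ge0 k; have k1 := cbrt_ge0 k.+1.
rewrite -(@ler_pXn2r _ 3) ?nnegrE ?addr_ge0 ?sqr_ge0 // -exprM mulnC exprM cbrtX3.
rewrite -natr1 -cbrtX3; move: (cbrt k) k0 => b b0.
rewrite -subr_ge0 (_ : _ - _ = b ^+ 2 * ((b - 1) ^+ 2 + 2 * b ^+ 2 + 2)); last by ring.
by apply: mulr_ge0; rewrite ?sqr_ge0 //; have := sqr_ge0 (b - 1); have := sqr_ge0 b; lra.
Qed.

(** Telescoping: with [a^3 = b^3 + 1] one has [1/a <= 2 a^2 - 2 b^2]. *)
Lemma sum_cbrtV T : \sum_(t < T) (cbrt (t + 8))^-1 <= 2 * cbrt T ^+ 2.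
Proof.
elim: T => [|T IH]; first by rewrite big_ord0 mulr_ge0 ?sqr_ge0.
rewrite big_ord_recr /=.
have a1 := @cbrt_ge1 T.+1 (ltn0Sn _); have b0 := cbrt_ge0 T.
have ba : cbrt T <= cbrt T.+1 by exact: cbrt_homo.
have ab : cbrt T.+1 ^+ 3 = cbrt T ^+ 3 + 1 by rewrite !cbrtX3 -natr1.
have : (cbrt (T + 8))^-1 <= (cbrt T.+1)^-1.
  rewrite lef_pV2 ?posrE ?(lt_le_trans ltr01) ?cbrt_ge1 ?addnS //; apply: cbrt_homo; lia.
move: IH; set s := \sum_(i < T) _; set c := (cbrt (T + 8))^-1.
move: (cbrt T) (cbrt T.+1) a1 b0 ba ab => b a a1 b0 ba ab IH ca.
suff : a^-1 <= 2 * a ^+ 2 - 2 * b ^+ 2 by lra.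
rewrite -div1r ler_pdivrMr; last by lra.
have : 0 <= (a - b) * (a * (a - b) + b * (2 * a - b)).
  by apply: mulr_ge0; [lra|apply: addr_ge0; apply: mulr_ge0; lra].
lra.
Qed.

Lemma rhoE t : rho R t = 4 / cbrt (t + 8) ^+ 2.
Proof. by rewrite /rho cbrtX2. Qed.

Lemma cbrt_sqr_ge4 t : 4 <= cbrt (t + 8) ^+ 2.
Proof.
have : 2 <= cbrt (t + 8) by apply: cbrt_ge; rewrite -natrX ler_nat leq_addl.
nra.
Qed.

Lemma rho_gt0 t : 0 < rho R t.
Proof. by rewrite rhoE divr_gt0 // (lt_le_trans _ (cbrt_sqr_ge4 t)). Qed.

Lemma rho_le1 t : rho R t <= 1.
Proof.
rewrite rhoE ler_pdivrMr ?mul1r ?cbrt_sqr_ge4 //.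
by rewrite (lt_le_trans _ (cbrt_sqr_ge4 t)).
Qed.

(** [Q / (t+8)^(2/3)] is a supersolution of the error recursion.  With
    [p = (t+8)^(2/3)] and [q = (t+7)^(2/3) >= p - 1], the contraction gains
    [3 Q / (p (p - 1))], while both error sources are of order [1 / p^2]: the
    drift because [T > t], the variance because it is damped by [rho^2]. *)
Lemma error_recursion (G M Q : R) t T : (0 < t < T)%N ->
  0 <= M -> 6 * G ^+ 2 + 16 * M <= 3 * Q ->
  (1 - rho R t) * (Q / cbrt (t.-1 + 8) ^+ 2) + (G / T%:R) ^+ 2 / rho R t
    + rho R t ^+ 2 * M <= Q / cbrt (t + 8) ^+ 2.
Proof.
move=> /andP[t0 tT] M0 BQ; rewrite rhoE.
have pE : cbrt (t + 8) ^+ 2 <= cbrt (t.-1 + 8) ^+ 2 + 1.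
  by rewrite -{1}(prednK t0) addSn cbrtS_sqr.
have p4 := cbrt_sqr_ge4 t; have q4 := cbrt_sqr_ge4 t.-1.
have T0 : (0 : R) < T%:R by rewrite ltr0n (leq_trans _ tT).
have p3 : (cbrt (t + 8) ^+ 2) ^+ 3 <= 81 / 4 * T%:R ^+ 2.
  rewrite -exprM mulnC exprM cbrtX3.
  have : (2 * (t + 8)%:R : R) <= 9 * T%:R.
    by rewrite -!natrM ler_nat; lia.
  have : (0 : R) <= (t + 8)%:R by [].
  nra.
move: (cbrt (t + 8) ^+ 2) (cbrt (t.-1 + 8) ^+ 2) pE p4 q4 p3 => p q pE p4 q4 p3.
have Q0 : 0 <= Q by have := sqr_ge0 G; lra.
have h1 : (G / T%:R) ^+ 2 / (4 / p) <= 6 * G ^+ 2 / p ^+ 2.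
  rewrite ler_pdivlMr; last by rewrite exprn_gt0 //; lra.
  rewrite (_ : _ * p ^+ 2 = G ^+ 2 * (p ^+ 3 / (4 * T%:R ^+ 2))); last first.
    by field; rewrite ?(gt_eqF T0) //=; apply/eqP; lra.
  rewrite mulrC ler_wpM2r ?sqr_ge0 // ler_pdivrMr; last by rewrite mulr_gt0 ?exprn_gt0.
  have := sqr_ge0 (T%:R : R); lra.
have h2 : (1 - 4 / p) * (Q / q) <= (1 - 4 / p) * (Q / (p - 1)).
  rewrite ler_wpM2l //; first by rewrite subr_ge0 ler_pdivrMr; lra.
  by rewrite ler_wpM2l // lef_pV2 ?posrE; lra.
have h3 : (1 - 4 / p) * (Q / (p - 1)) + (6 * G ^+ 2 + 16 * M) / p ^+ 2 <= Q / p.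
  apply: (@le_trans _ _ ((1 - 4 / p) * (Q / (p - 1)) + 3 * Q / p ^+ 2)).
    by rewrite lerD2l ler_wpM2r // invr_ge0 exprn_ge0 //; lra.
  rewrite -subr_ge0 (_ : _ - _ = 3 * Q / ((p - 1) * p ^+ 2)); last first.
    by field; apply/andP; split; apply/eqP; lra.
  by rewrite divr_ge0 ?mulr_ge0 ?exprn_ge0 //; lra.
have h4 : (4 / p) ^+ 2 * M = 16 * M / p ^+ 2 by field; apply/eqP; lra.
move: h3; rewrite mulrDl h4; lra.
Qed.

Lemma expr_le_expRN1 T : (0 < T)%N -> (1 - T%:R^-1) ^+ T <= (expR (1 : R))^-1.
Proof.
move=> T0; rewrite -expRN.
have -> : - (1 : R) = T%:R * (- T%:R^-1).
  by rewrite mulrN divff // pnatr_eq0 -lt0n.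
rewrite expRM_natl ler_pXn2r ?nnegrE ?expR_ge0 //; first exact: expR_ge1Dx.
by rewrite subr_ge0 invf_le1 ?ltr0n // ler1n.
Qed.

End StepSizes.

(** * The ascent inequality along a run *)

Section Pathwise.
Context {R : realType} {n : nat}.

Definition sqnorm (u : 'rV[R]_n) : R := \sum_(i < n) u ord0 i ^+ 2.

Lemma sqnorm_ge0 u : 0 <= sqnorm u.
Proof. by apply: sumr_ge0 => i _; exact: sqr_ge0. Qed.

Lemma enormX2 u : enorm u ^+ 2 = sqnorm u.
Proof. by rewrite sqr_sqrtr // sqnorm_ge0. Qed.

Lemma contraction_le (q : R) (a b : nat -> R) T : 0 <= q <= 1 ->
  (forall t, 0 <= b t) ->
  (forall t, (t < T)%N -> a t.+1 <= q * a t + b t) ->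
  a T <= q ^+ T * a 0%N + \sum_(t < T) b t.
Proof.
move=> /andP[q0 q1] b0; elim: T => [|T IH] step; first by rewrite big_ord0 mul1r addr0.
rewrite big_ord_recr /= exprS -mulrA addrA; apply: (le_trans (step T _)) => //.
rewrite lerD2r; have := IH (fun t tT => step t (ltnW tT)).
have : 0 <= \sum_(t < T) b t by apply: sumr_ge0.
move: (\sum_(t < T) b t) (q ^+ T * _) (a T) => B A aT B0 aTA; nra.
Qed.

(** Completing squares coordinatewise.  In contrast with Cauchy-Schwarz, the
    bound is affine in [sqnorm u], whose expectation is the quantity that the
    variance recursion controls; [c] is the guess for the size of [u]. *)
Lemma dotpB_ge (u v w : 'rV[R]_n) (D' c : R) : 0 < D' -> 0 < c ->
  sqnorm v <= D' ^+ 2 -> sqnorm w <= D' ^+ 2 ->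
  - (D' * (sqnorm u / c + c)) <= dotp u v - dotp u w.
Proof.
move=> D0 c0 vD wD.
have E : dotp u v - dotp u w + D' * (sqnorm u / c + c) =
   \sum_(i < n) ((D' / c) * (u ord0 i + c / (2 * D') * (v ord0 i - w ord0 i)) ^+ 2
      + c / (4 * D') * (v ord0 i + w ord0 i) ^+ 2)
   + c / (2 * D') * (2 * D' ^+ 2 - sqnorm v - sqnorm w).
  rewrite /sqnorm /dotp.
  transitivity (\sum_(i < n) (u ord0 i * v ord0 i - u ord0 i * w ord0 i
      + D' / c * u ord0 i ^+ 2) + D' * c).
    rewrite big_split /= sumrB -mulr_sumr; field; exact: lt0r_neq0.
  have -> : \sum_(i < n) ((D' / c) * (u ord0 i + c / (2 * D') * (v ord0 i - w ord0 i)) ^+ 2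
      + c / (4 * D') * (v ord0 i + w ord0 i) ^+ 2) =
    \sum_(i < n) (u ord0 i * v ord0 i - u ord0 i * w ord0 i
      + D' / c * u ord0 i ^+ 2) + c / (2 * D') * (\sum_i v ord0 i ^+ 2 + \sum_i w ord0 i ^+ 2).
    rewrite mulrDr !mulr_sumr -!big_split /=; apply: eq_bigr => i _.
    by field; rewrite !lt0r_neq0.
  by field; rewrite !lt0r_neq0.
rewrite lerNl -subr_ge0 opprK addrC E; apply: addr_ge0.
  apply: sumr_ge0 => i _; apply: addr_ge0; apply: mulr_ge0; rewrite ?sqr_ge0 //.
    by rewrite divr_ge0 // ltW.
  by rewrite divr_ge0 ?mulr_ge0 // ltW.
apply: mulr_ge0; first by rewrite divr_ge0 ?mulr_ge0 // ltW.
lra.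
Qed.

Variables (I : {set {set 'I_n}}) (f : {set 'I_n} -> R) (m D' OPT : R).
Hypotheses (f_ge0 : forall A, 0 <= f A) (f_mono : monotone_setfun f)
  (f_submod : submodular_setfun f) (m_ge0 : 0 <= m)
  (f_single : forall i, f [set i]%SET <= m).
Local Notation F := (multilinear f).
Local Notation C := (matroid_polytope R I).
Hypotheses (D'_gt0 : 0 < D') (C_bound : forall u, C u -> sqnorm u <= D' ^+ 2)
  (OPT_max : maximum_of [set F u | u in C] OPT).
Variables (T : nat) (x d v : nat -> 'rV[R]_n).
Hypotheses (T_gt0 : (0 < T)%N) (x0 : x 0%N = 0)
  (vP : forall t, (t < T)%N -> argmax C (d t) (v t))
  (xS : forall t, (t < T)%N -> x t.+1 = x t + T%:R^-1 *: v t).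

Let T0 : (0 : R) < T%:R. Proof. by rewrite ltr0n. Qed.

Lemma iterate_dilated t : (t <= T)%N -> dilated_polytope I (t%:R / T%:R) (x t).
Proof.
elim: t => [|t IH] tT; first by rewrite x0 mul0r; exact: dilated_polytope0.
rewrite xS // -natr1 mulrDl mul1r; apply: dilated_polytopeD; first exact/IH/ltnW.
  by case: (vP tT).
by rewrite invr_ge0.
Qed.

Lemma iterate_cube t : (t <= T)%N -> in_cube (x t).
Proof.
move=> tT; apply: dilated_polytope_cube (iterate_dilated tT).
by rewrite ler_pdivrMr ?mul1r ?ler_nat.
Qed.

Lemma iterate_feasible : C (x T).
Proof. by have := iterate_dilated (leqnn T); rewrite divff ?gt_eqF. Qed.

(** One step closes the fraction [1/T] of the gap, up to the curvature of [F] and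
    to the loss from maximizing over [d t] instead of the gradient. *)
Lemma iterate_progress t (c : R) : (t < T)%N -> 0 < c ->
  OPT - F (x t.+1) <= (1 - T%:R^-1) * (OPT - F (x t)) +
   (m * (matroid_rank I)%:R ^+ 2 / T%:R ^+ 2 +
    D' / T%:R * (sqnorm (grad F (x t) - d t) / c + c)).
Proof.
move=> tT c0; have [Cv vmax] := vP tT.
have [[xs Cxs Fxs] _] := OPT_max.
have cubeC u : C u -> in_cube u.
  by move=> Cu; apply: (@dilated_polytope_cube _ _ I 1).
have xc := iterate_cube (ltnW tT); have xc' := iterate_cube tT.
have V0 : 0 <= (T%:R^-1 : R) by rewrite invr_ge0 ltW.
rewrite xS // in xc' *.
have := multilinear_progress f_ge0 f_mono f_submod f_single V0 m_ge0 xc xc'.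
move=> /(_ _ (fun j => dilated_polytope_ge0 j (Cv : dilated_polytope I 1 (v t)))).
move=> /(_ _ (polytope_sum_le Cv)).
have gap := multilinear_gap f_mono f_submod xc (cubeC _ Cxs).
have opt := vmax _ Cxs.
have := dotpB_ge (grad F (x t) - d t) D'_gt0 c0 (C_bound Cv) (C_bound Cxs).
have dotpBl u u' w : dotp (u - u') w = dotp u w - dotp u' w.
  by rewrite /dotp -sumrB; apply: eq_bigr => i _; rewrite !mxE mulrBl.
rewrite !dotpBl; set E := sqnorm _ / c + c => amgm prog.
have key : OPT - F (x t) - D' * E <= dotp (grad F (x t)) (v t) by rewrite -Fxs; lra.
have := ler_wpM2l V0 key; rewrite exprVn in prog.
move: prog; set a := T%:R^-1; set b := (T%:R ^+ 2)^-1; lra.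
Qed.

(** Unroll the contraction.  The sequences are those of a single outcome of the
    run, so that one expectation at the very end suffices. *)
Lemma iterate_gap (c : nat -> R) : (forall t, 0 < c t) ->
  (1 - (expR 1)^-1) * OPT <= F (x T) + (m * (matroid_rank I)%:R ^+ 2 / T%:R +
    \sum_(t < T) D' / T%:R * (sqnorm (grad F (x t) - d t) / c t + c t)).
Proof.
move=> c0; set b := fun t : nat => D' / T%:R * (sqnorm (grad F (x t) - d t) / c t + c t).
have cube0 : in_cube (0 : 'rV[R]_n) by move=> j; rewrite mxE lexx ler01.
have Fge0 u : in_cube u -> 0 <= F u.
  by move=> uc; rewrite -[leLHS](multilinear_cst 0 u) ler_multilinear.
have OPT0 : 0 <= OPT.
  have [[xs Cxs <-] _] := OPT_max; apply: Fge0.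
  by apply: (@dilated_polytope_cube _ _ I 1).
have q01 : 0 <= 1 - (T%:R^-1 : R) <= 1.
  by rewrite subr_ge0 invf_le1 // ler1n T_gt0 gerBl invr_ge0 ltW.
have b0 t : 0 <= m * (matroid_rank I)%:R ^+ 2 / T%:R ^+ 2 + b t.
  rewrite addr_ge0 // ?divr_ge0 ?mulr_ge0 ?sqr_ge0 //.
    by rewrite ltW // divr_gt0.
  by rewrite addr_ge0 // ?divr_ge0 ?sqnorm_ge0 // ltW.
have := contraction_le (a := fun t => OPT - F (x t)) q01 b0
  (fun t tT => iterate_progress tT (c0 t)).
rewrite big_split /= sumr_const card_ord x0.
have -> : m * (matroid_rank I)%:R ^+ 2 / T%:R ^+ 2 *+ T = m * (matroid_rank I)%:R ^+ 2 / T%:R.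
  by rewrite -mulr_natr; field; rewrite gt_eqF.
have q0 : 0 <= (1 - T%:R^-1 : R) ^+ T by rewrite exprn_ge0 //; case/andP: q01.
have := ler_wpM2l q0 (_ : OPT - F 0 <= OPT); rewrite gerBl Fge0 // => /(_ isT).
have := ler_wpM2r OPT0 (@expr_le_expRN1 R T T_gt0).
rewrite mulrBl mul1r; lra.
Qed.

End Pathwise.

(** * Integrating out a fresh sample *)

Section Transfer.
Local Open Scope ereal_scope.
Context {d1 d2 : measure_display} {X : measurableType d1} {Y : measurableType d2}
  {R : realType}.
Variables (psi : X -> Y) (mpsi : measurable_fun setT psi).
Variables (mu : {measure set X -> \bar R}) (nu : {measure set Y -> \bar R}).
Variables (p : X -> R) (mp : measurable_fun setT p) (p_ge0 : forall x, (0 <= p x)%R).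
Hypothesis nuE : forall W, measurable W -> nu W = \int[mu]_(x in psi @^-1` W) (p x)%:E.

Import HBNNSimple.

Let mpre W : measurable W -> measurable (psi @^-1` W).
Proof. by move=> mW; rewrite -[X in measurable X]setTI; exact: mpsi. Qed.

Let transfer_nnsfun (h : {nnsfun Y >-> R}) :
  \int[nu]_y (h y)%:E = \int[mu]_x ((h (psi x))%:E * (p x)%:E).
Proof.
transitivity (\sum_(k \in range h)
    \int[mu]_x ((k * \1_(h @^-1` [set k]) (psi x))%:E * (p x)%:E)); last first.
  rewrite -ge0_integral_fsum//.
  - apply: eq_integral => x _; rewrite [in RHS](fimfunE h (psi x)) -fsumEFin//.
    by rewrite ge0_mule_fsuml // => i; rewrite nnfun_muleindic_ge0.
  - move=> k; apply: emeasurable_funM; last exact/measurable_EFinP.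
    apply/measurable_EFinP/measurable_funM; first exact: measurable_cst.
    exact: (measurableT_comp _ mpsi).
  - move=> k x _; apply: mule_ge0; last by rewrite lee_fin.
    by rewrite EFinM; exact: nnfun_muleindic_ge0.
under eq_integral do rewrite fimfunE -fsumEFin//.
rewrite ge0_integral_fsum//; last 2 first.
- by move=> y; exact/measurable_EFinP/measurable_funM.
- by move=> y x _; rewrite nnfun_muleindic_ge0.
apply: eq_fsbigr => k /[!inE] -[y _ hk].
have k0 : (0 <= k)%R by rewrite -hk.
rewrite integralZl_indic_nnsfun// integral_indic// setIT nuE//.
under [RHS]eq_integral do rewrite EFinM -muleA.
rewrite ge0_integralZl//; last 2 first.
- apply: emeasurable_funM; last exact/measurable_EFinP.
  apply/measurable_EFinP; exact: (measurableT_comp _ mpsi).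
- by move=> x _; rewrite mule_ge0 ?lee_fin.
congr (_ * _); rewrite integral_mkcond; apply: eq_integral => x _.
rewrite patchE indicE; case: ifPn => [/set_mem|/negP] hx.
  by rewrite mem_set// mul1e.
by rewrite memNset ?mul0e// => hk'; apply: hx; rewrite inE.
Qed.

(** Integration against the image under [psi] of the measure with density [p]
    with respect to [mu]: true for simple functions by the assumption on
    measurable sets, and extended by monotone convergence. *)
Lemma ge0_integral_transfer (f : Y -> \bar R) : measurable_fun setT f ->
  (forall y, 0 <= f y) ->
  \int[nu]_y f y = \int[mu]_x (f (psi x) * (p x)%:E).
Proof.
move=> mf f0; pose f_ := nnsfun_approx measurableT mf.
have cvgf y : limn (EFin \o f_ ^~ y) = f y.
  by apply/cvg_lim => //; apply: cvg_nnsfun_approx => // *; exact: f0.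
transitivity (limn (fun n => \int[nu]_y (f_ n y)%:E)).
  rewrite -monotone_convergence//.
  - by apply: eq_integral => y _; rewrite -cvgf.
  - by move=> n; exact/measurable_EFinP/measurable_funP.
  - by move=> n y _; rewrite lee_fin.
  - by move=> y _ m n mn; rewrite lee_fin; exact/lefP/nd_nnsfun_approx.
under eq_fun do rewrite transfer_nnsfun.
rewrite -monotone_convergence//.
- apply: eq_integral => x _; apply/cvg_lim => //.
  rewrite muleC; under eq_fun do rewrite muleC.
  by apply: cvgeZl => //; apply: cvg_nnsfun_approx => // *; exact: f0.
- move=> n; apply: emeasurable_funM; last exact/measurable_EFinP.
  by apply/measurable_EFinP; exact: (measurableT_comp _ mpsi).
- by move=> n x _; rewrite mule_ge0 ?lee_fin.
- move=> x _ m n mn; rewrite lee_wpmul2r ?lee_fin//.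
  exact/lefP/nd_nnsfun_approx.
Qed.

End Transfer.

Section FreshSample.
Local Open Scope ereal_scope.
Context {dO dZ : measure_display} {O : measurableType dO} {Z : measurableType dZ}
  {R : realType}.
Variables (Pr : probability O R) (P : probability Z R) (G : set (set O)).
Hypothesis Gm : <<s G >> `<=` measurable.
Local Notation OG := (g_sigma_algebraType G).
Variables (zt : O -> Z) (SA : set O) (p : O -> R).
Hypotheses (mz : measurable_fun setT zt) (mSA : measurable SA)
  (mp : measurable_fun setT p) (p_ge0 : forall w, (0 <= p w)%R).
Hypothesis fresh : forall E B, <<s G >> E -> measurable B ->
  Pr (E `&` zt @^-1` B `&` SA) = P B * \int[Pr]_(w in E) (p w)%:E.

Let pair_map (w : O) : OG * Z := (w, zt w).

Lemma measurable_coarsen : measurable_fun setT (id : O -> OG).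
Proof. by move=> _ E mE; rewrite setTI; exact: Gm. Qed.

Lemma measurable_pair_map : measurable_fun setT pair_map.
Proof. by apply/measurable_fun_pair => //; exact: measurable_coarsen. Qed.

Let restricted (E : set OG) : \bar R := Pr ((E : set O) `&` SA).

Let restricted0 : restricted set0 = 0.
Proof. by rewrite /restricted set0I measure0. Qed.

Let restricted_ge0 E : 0 <= restricted E.
Proof. exact: (measure_ge0 Pr). Qed.

Let restricted_sigma_additive : semi_sigma_additive restricted.
Proof.
move=> F mF tF mUF.
apply: (@measure_semi_sigma_additive _ _ _ (mrestr Pr mSA) F) => //.
  by move=> n; apply: Gm; exact: mF.
by apply: Gm; exact: mUF.
Qed.

HB.instance Definition _ := isMeasure.Build _ OG R
  restricted restricted0 restricted_ge0 restricted_sigma_additive.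

Let restricted_fin : fin_num_fun restricted.
Proof. by move=> E mE; apply: fin_num_measure; apply: measurableI => //; exact: Gm. Qed.

HB.instance Definition _ := Measure_isFinite.Build _ OG R restricted restricted_fin.

Let joint (W : set (OG * Z)) : \bar R := Pr (pair_map @^-1` W `&` SA).

Let joint0 : joint set0 = 0.
Proof. by rewrite /joint preimage_set0 set0I measure0. Qed.

Let joint_ge0 E : 0 <= joint E.
Proof. exact: (measure_ge0 Pr). Qed.

Let mpre W : measurable W -> measurable (pair_map @^-1` W).
Proof. by move=> mW; rewrite -[X in measurable X]setTI; exact: measurable_pair_map. Qed.

Let joint_sigma_additive : semi_sigma_additive joint.
Proof.
move=> F mF tF mUF; rewrite /joint preimage_bigcup.
apply: (@measure_semi_sigma_additive _ _ _ (mrestr Pr mSA) (fun n => pair_map @^-1` F n)) => //.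
- by move=> n; exact: mpre.
- apply/trivIsetP => /= i j _ _ ij; rewrite -preimage_setI.
  by move/trivIsetP : tF => /(_ _ _ _ _ ij) ->//; rewrite preimage_set0.
- by rewrite -preimage_bigcup; exact: mpre.
Qed.

HB.instance Definition _ := isMeasure.Build _ (OG * Z)%type R
  joint joint0 joint_ge0 joint_sigma_additive.

(** Freeze the past and integrate out the fresh sample.  On the event [SA], the
    law of the pair of the past and [zt] agrees on rectangles with the product of
    the restriction of [Pr] and [P], hence is that product, and Tonelli applies.
    Freshness with [B = setT] says that [p] is the density of the restricted
    measure on the past. *)
Lemma ge0_integral_fresh (phi : OG * Z -> \bar R) : measurable_fun setT phi ->
  (forall u, 0 <= phi u) ->
  \int[Pr]_(w in SA) phi (w, zt w) =
  \int[Pr]_w ((\int[P]_z phi (w, z)) * (p w)%:E).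
Proof.
move=> mphi phi0.
have restrictedE E : <<s G >> E -> restricted E = \int[Pr]_(w in E) (p w)%:E.
  move=> GE; have := fresh GE measurableT.
  by rewrite preimage_setT setIT probability_setT mul1e.
have jointE W : measurable W -> (restricted \x P) W = joint W.
  apply: product_measure_unique => E B mE mB.
  rewrite [LHS](_ : _ = Pr (E `&` zt @^-1` B `&` SA)) // fresh //.
  by rewrite muleC -restrictedE.
transitivity (\int[joint]_u phi u).
  transitivity (\int[Pr]_w (phi (pair_map w) * (\1_SA w)%:E)).
    rewrite integral_mkcond; apply: eq_integral => w _.
    by rewrite patchE indicE; case: ifPn => _; rewrite ?mule1 ?mule0.
  apply/esym/ge0_integral_transfer => //; first exact: measurable_pair_map.
  by move=> W mW; rewrite integral_indic//; [rewrite setIC|exact: mpre].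
transitivity (\int[restricted \x P]_u phi u).
  by apply: eq_measure_integral => W mW _; exact/esym/jointE.
rewrite fubini_tonelli1//.
apply: (ge0_integral_transfer measurable_coarsen (mu := Pr) (p := p)) => //.
- exact: measurable_fun_fubini_tonelli_F.
- by move=> w; exact: integral_ge0.
Qed.

End FreshSample.

(** * Bias and variance of the gradient estimate *)

Section OneSample.
Local Open Scope ereal_scope.
Context {R : realType} {n : nat} {dZ : measure_display} {Z : measurableType dZ}.
Variable P : probability Z R.

Lemma integral_probability_cst (c : R) : \int[P]_z c%:E = c%:E.
Proof. by have := expectation_cst P c; rewrite unlock. Qed.

Lemma integral_sqnorm_shift (h : Z -> 'rV[R]_n) (b e : 'rV[R]_n) (a W : R) :
  (forall i, measurable_fun setT (fun z => h z ord0 i)) ->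
  (forall i, P.-integrable setT (fun z => (h z ord0 i)%:E)) ->
  (forall i, \int[P]_z (h z ord0 i)%:E = (b ord0 i)%:E) ->
  \int[P]_z (sqnorm (h z))%:E = W%:E ->
  \int[P]_z (sqnorm (e - a *: h z))%:E =
    (sqnorm e - 2 * a * dotp e b + a ^+ 2 * W)%:E.
Proof.
move=> mh ih hb hW.
have msq : measurable_fun setT (fun z => sqnorm (h z)).
  by apply: measurable_sum => i; apply: measurable_funX; exact: mh.
have isq : P.-integrable setT (fun z => (sqnorm (h z))%:E).
  apply/integrableP; split; first exact/measurable_EFinP.
  under eq_integral do rewrite gee0_abs ?lee_fin ?sqnorm_ge0//.
  by rewrite hW ltry.
pose g i z : \bar R := (- (2 * a * e ord0 i))%:E * (h z ord0 i)%:E.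
have ig i : P.-integrable setT (g i) by apply: integrableZl.
transitivity (\int[P]_z (((sqnorm e)%:E + \sum_(i < n) g i z) + (a ^+ 2)%:E * (sqnorm (h z))%:E)).
  apply: eq_integral => z _; rewrite /g sumEFin -EFinM -!EFinD; congr EFin.
  rewrite /sqnorm mulr_sumr -!big_split /=; apply: eq_bigr => i _.
  by rewrite !mxE; ring.
have ic : P.-integrable setT (fun=> (sqnorm e)%:E).
  exact: (finite_measure_integrable_cst P (sqnorm e) measurableT).
have isum : P.-integrable setT (fun z => \sum_(i < n) g i z).
  by apply: integrable_sum => // i _.
rewrite integralD//; [|exact: integrableD|exact: integrableZl].
rewrite integralD// integralZl// hW integral_probability_cst.
rewrite integral_sum//.
under eq_bigr => i _ do rewrite integralZl// hb -EFinM.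
rewrite sumEFin -EFinM -!EFinD; congr EFin; congr (_ + _)%R; congr (_ + _)%R.
by rewrite /dotp mulr_sumr -sumrN; apply: eq_bigr => i _; ring.
Qed.

Variables (ft : {set 'I_n} -> Z -> R) (f : {set 'I_n} -> R) (M : R).
Hypotheses (mft : forall A, measurable_fun setT (ft A))
  (ft_ge0 : forall A z, (0 <= ft A z)%R) (Eft : forall A, 'E_P[ft A] = (f A)%:E).

Lemma grad_estE A z i : grad_est ft A z ord0 i = (ft (i |: A)%SET z - ft (A :\ i)%SET z)%R.
Proof. by rewrite mxE. Qed.

Lemma measurable_grad_est A i : measurable_fun setT (fun z => grad_est ft A z ord0 i).
Proof.
under eq_fun do rewrite grad_estE.
by apply: measurable_funB; exact: mft.
Qed.

Let integrable_ft A : P.-integrable setT (EFin \o ft A).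
Proof.
apply/integrableP; split; first exact/measurable_EFinP.
under eq_integral do rewrite gee0_abs ?lee_fin ?ft_ge0//.
by have := Eft A; rewrite unlock => ->; rewrite ltry.
Qed.

Lemma integrable_grad_est A i : P.-integrable setT (fun z => (grad_est ft A z ord0 i)%:E).
Proof.
under eq_fun do rewrite grad_estE EFinB.
by apply: integrableB => //; exact: integrable_ft.
Qed.

Lemma expectation_grad_est A i :
  \int[P]_z (grad_est ft A z ord0 i)%:E = (marginal f i A)%:E.
Proof.
under eq_integral do rewrite grad_estE EFinB.
rewrite integralB//; [|exact: integrable_ft|exact: integrable_ft].
have := Eft (i |: A)%SET; have := Eft (A :\ i)%SET.
by rewrite unlock => -> ->.
Qed.

Local Notation gradF x := (grad (multilinear f) x).

(** Averaged over both [z] and the random set the estimate is unbiased, so the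
    cross term of the square vanishes.  For a set of positive probability the
    variance hypothesis itself forces the second moment to be finite; the other
    sets contribute nothing. *)
Lemma conditional_variance (x e : 'rV[R]_n) (a : R) : in_cube x ->
  \sum_(A : {set 'I_n}) (set_prob x A)%:E *
     'E_P[(fun z => enorm (grad_est ft A z - gradF x) ^+ 2)%R] <= (n%:R * M)%:E ->
  \sum_(A : {set 'I_n})
     (\int[P]_z (sqnorm (e - a *: (grad_est ft A z - gradF x)))%:E) * (set_prob x A)%:E
  <= (sqnorm e + a ^+ 2 * (n%:R * M))%:E.
Proof.
move=> xc.
pose W A := \int[P]_z (sqnorm (grad_est ft A z - gradF x))%:E.
have W0 A : 0 <= W A by apply: integral_ge0 => z _; rewrite lee_fin sqnorm_ge0.
rewrite (eq_bigr (fun A => (set_prob x A)%:E * W A)); last first.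
  by move=> A _; rewrite unlock; under eq_integral do rewrite enormX2.
move=> HW.
pose b A : 'rV[R]_n := (\row_i marginal f i A - gradF x)%R.
have Wfin A : (0 < set_prob x A)%R -> W A \is a fin_num.
  move=> p0; rewrite ge0_fin_numE //.
  have : (set_prob x A)%:E * W A < +oo.
    apply: le_lt_trans (le_lt_trans HW (ltry _)).
    rewrite (bigD1 A) //= leeDl // sume_ge0 // => B _.
    by rewrite mule_ge0 // lee_fin set_prob_ge0.
  by case: (W A) (W0 A) => [s _ _|_|]; rewrite ?ltry ?gt0_muley ?lte_fin.
have term A : (\int[P]_z (sqnorm (e - a *: (grad_est ft A z - gradF x)))%:E)
    * (set_prob x A)%:E =
   (set_prob x A * sqnorm e - 2 * a * (set_prob x A * dotp e (b A)))%:E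
     + (a ^+ 2)%:E * ((set_prob x A)%:E * W A).
  have := set_prob_ge0 A xc; rewrite le_eqVlt => /predU1P[<-|p0].
    by rewrite mule0 !mul0r mulr0 subr0 mul0e mule0 adde0.
  rewrite (@integral_sqnorm_shift _ (b A) e a (fine (W A))); last 4 first.
  - move=> i; under eq_fun do rewrite mxE.
    by apply: measurable_funD => //; exact: measurable_grad_est.
  - move=> i; under eq_fun do rewrite mxE EFinD.
    apply: integrableD => //; first exact: integrable_grad_est.
    exact: (finite_measure_integrable_cst P _ measurableT).
  - move=> i; under eq_integral do rewrite mxE EFinD.
    rewrite integralD//; last 2 first.
      exact: integrable_grad_est.
      exact: (finite_measure_integrable_cst P _ measurableT).
    rewrite expectation_grad_est integral_probability_cst.
    by rewrite -EFinD !mxE.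
  - by rewrite fineK ?Wfin.
  by rewrite -(fineK (Wfin A p0)) -!EFinM -EFinD; congr EFin; rewrite /=; ring.
rewrite (eq_bigr _ (fun A _ => term A)) big_split /= sumEFin.
rewrite -ge0_sume_distrr; last by move=> A _; rewrite mule_ge0 // lee_fin set_prob_ge0.
have -> : (\sum_A (set_prob x A * sqnorm e - 2 * a * (set_prob x A * dotp e (b A))) = sqnorm e)%R.
  rewrite sumrB -mulr_suml set_prob_sum mul1r -mulr_sumr.
  suff -> : (\sum_A set_prob x A * dotp e (b A) = 0)%R by rewrite mulr0 subr0.
  under eq_bigr do rewrite /dotp mulr_sumr.
  rewrite exchange_big big1 //= => i _.
  transitivity (e ord0 i *
      (\sum_A (marginal f i A * set_prob x A - set_prob x A * gradF x ord0 i)))%R.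
    by rewrite mulr_sumr; apply: eq_bigr => A _; rewrite !mxE; ring.
  rewrite sumrB -mulr_suml set_prob_sum mul1r grad_multilinear.
  by rewrite /multilinear subrr mulr0.
rewrite EFinD leeD2l // [leRHS]EFinM; apply: lee_wpmul2l => //; by rewrite lee_fin sqr_ge0.
Qed.

End OneSample.

(** * Measurability of a run *)

Section CoordinateMeasurability.
Context {R : realType} {n : nat} {d : measure_display} {X : measurableType d}.
Variable (u : X -> 'rV[R]_n).
Hypothesis mu : forall i, measurable_fun setT (fun w => u w ord0 i).

Lemma measurable_sqnorm : measurable_fun setT (fun w => sqnorm (u w)).
Proof. by apply: measurable_sum => i; apply: measurable_funX; exact: mu. Qed.

Lemma measurable_set_prob A : measurable_fun setT (fun w => set_prob (u w) A).
Proof.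
under eq_fun do rewrite set_probE.
apply: measurable_prod => i _; rewrite /coord_prob; case: (i \in A); first exact: mu.
by apply: measurable_funB => //; exact: mu.
Qed.

Lemma measurable_multilinear f : measurable_fun setT (fun w => multilinear f (u w)).
Proof.
by apply: measurable_sum => A; apply: measurable_funM => //; exact: measurable_set_prob.
Qed.

Lemma measurable_grad f i :
  measurable_fun setT (fun w => grad (multilinear f) (u w) ord0 i).
Proof. under eq_fun do rewrite grad_multilinear; exact: measurable_multilinear. Qed.

End CoordinateMeasurability.

Section Run.
Context {R : realType} {n : nat} {dZ : measure_display} {Z : measurableType dZ}
  {dO : measure_display} {O : measurableType dO}.
Variables (C : set 'rV[R]_n) (ft : {set 'I_n} -> Z -> R) (f : {set 'I_n} -> R)
  (P : probability Z R) (Pr : probability O R) (T : nat)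
  (z : nat -> O -> Z) (S : nat -> O -> {set 'I_n}) (x d v : nat -> O -> 'rV[R]_n).
Hypotheses (run : SCG C ft P Pr T z S x d v)
  (mft : forall A, measurable_fun setT (ft A)).

(** The generating family of [history z S t], named so that
    [g_sigma_algebraType] turns the history into a measurable structure. *)
Definition samples (t : nat) : set (set O) :=
  [set E | exists2 s, (1 <= s <= t)%N &
        (exists2 B, measurable B & E = z s @^-1` B) \/
        (exists A, E = S s @^-1` [set A])].

Local Notation O_ t := (g_sigma_algebraType (samples t)).

Lemma history_sub s t : (s <= t)%N -> history z S s `<=` history z S t.
Proof.
move=> st; apply: sub_sigma_algebra2 => E [k /andP[k1 ks] kE].
by exists k => //; rewrite k1 (leq_trans ks).
Qed.

Lemma history_measurable t : (t < T)%N -> history z S t `<=` measurable.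
Proof.
move=> tT; apply: smallest_sub; first exact: sigma_algebra_measurable.
move=> E [s /andP[s1 st]]; have sT : (1 <= s < T)%N by rewrite s1 (leq_ltn_trans st).
case=> [[B mB ->]|[A ->]]; last exact: scg_S_measurable run _ _ sT.
by rewrite -[X in measurable X]setTI; exact: scg_z_measurable run _ sT _ _ mB.
Qed.

Lemma measurable_fun_later s t (g : O -> R) : (s <= t)%N ->
  measurable_fun setT (g : O_ s -> R) -> measurable_fun setT (g : O_ t -> R).
Proof.
move=> st mg _ B mB; rewrite setTI; apply: (history_sub st).
by have := mg measurableT B mB; rewrite setTI.
Qed.

Lemma measurable_fun_ambient t (g : O -> R) : (t < T)%N ->
  measurable_fun setT (g : O_ t -> R) -> measurable_fun setT g.
Proof.
move=> tT mg _ B mB; rewrite setTI; apply: (history_measurable tT).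
by have := mg measurableT B mB; rewrite setTI.
Qed.

(** Split according to the finitely many values of [S t]. *)
Lemma measurable_sampled_grad t i : (0 < t)%N ->
  measurable_fun setT ((fun w => grad_est ft (S t w) (z t w) ord0 i) : O_ t -> R).
Proof.
move=> t0; have t1 : (1 <= t <= t)%N by rewrite t0 leqnn.
rewrite (_ : (fun w => _) = (fun w : O_ t =>
    \sum_A \1_(S t @^-1` [set A]) w * grad_est ft A (z t w) ord0 i)); last first.
  apply/funext => w; rewrite (bigD1 (S t w)) //= big1 ?addr0.
    by rewrite indicE mem_set // mul1r.
  by move=> A /eqP AS; rewrite indicE memNset ?mul0r // => /= e; apply: AS.
apply: measurable_sum => A; apply: measurable_funM.
  apply: measurable_indic; apply: sub_sigma_algebra.
  by exists t => //; right; exists A.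
apply: (measurableT_comp (measurable_grad_est mft A i)).
move=> _ B mB; rewrite setTI; apply: sub_sigma_algebra.
by exists t => //; left; exists B.
Qed.

Lemma measurable_iterate t i : (t <= T)%N ->
  measurable_fun setT ((fun w => x t w ord0 i) : O_ t.-1 -> R).
Proof.
elim: t => [|t IH] tT.
  by under eq_fun do rewrite (scg_x0 run); exact: measurable_cst.
under eq_fun do rewrite (scg_x run) // mxE.
apply: measurable_funD.
  by apply: measurable_fun_later (IH (ltnW tT)); exact: leq_pred.
under eq_fun do rewrite mxE; apply: measurable_funM => //.
by move=> _ B mB; rewrite setTI; exact: (scg_adapted run).
Qed.

Lemma measurable_direction t i : (t < T)%N ->
  measurable_fun setT ((fun w => d t w ord0 i) : O_ t -> R).
Proof.
elim: t => [|t IH] tT.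
  by under eq_fun do rewrite (scg_d0 run); exact: measurable_cst.
under eq_fun do rewrite (scg_d run) // mxE [X in X + _]mxE [X in _ + X]mxE.
apply: measurable_funD; apply: measurable_funM => //.
  by apply: measurable_fun_later (IH (ltnW tT)).
exact: measurable_sampled_grad.
Qed.

Lemma measurable_error t : (t < T)%N ->
  measurable_fun setT (fun w => sqnorm (grad (multilinear f) (x t w) - d t w)).
Proof.
move=> tT; apply: (measurable_fun_ambient tT); apply: measurable_sqnorm => i.
under eq_fun do rewrite mxE [X in _ + X]mxE.
apply: measurable_funB; last exact: measurable_direction.
apply: measurable_grad => j; apply: (@measurable_fun_later t.-1); first exact: leq_pred.
by apply: measurable_iterate; exact: ltnW.
Qed.

Lemma measurable_final_value : (0 < T)%N ->
  measurable_fun setT (fun w => multilinear f (x T w)).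
Proof.
move=> T0; apply: (@measurable_fun_ambient T.-1); first by rewrite prednK.
by apply: measurable_multilinear => i; exact: measurable_iterate.
Qed.

(** A bound on the conditional expectation given the past bounds the expectation:
    split according to the value [A] of [S t] and integrate out [z t] on each
    piece. *)
Lemma le_integral_sample t (phi : {set 'I_n} -> O_ t.-1 * Z -> R) (h : O -> \bar R) :
  (0 < t < T)%N -> (forall w, in_cube (x t w)) ->
  (forall A, measurable_fun setT (phi A)) -> (forall A u, 0 <= phi A u) ->
  measurable_fun setT h ->
  (forall w, \sum_A (\int[P]_y (phi A (w, y))%:E) * (set_prob (x t w) A)%:E <= h w)%E ->
  (\int[Pr]_w (phi (S t w) (w, z t w))%:E <= \int[Pr]_w h w)%E.
Proof.
move=> t1 xc mphi phi0 mh phih.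
have tT : (t.-1 < T)%N by case/andP: t1 => t0 tT; rewrite (leq_ltn_trans (leq_pred t)).
have mx i : measurable_fun setT ((fun w => x t w ord0 i) : O_ t.-1 -> R).
  by apply: measurable_iterate; case/andP: t1 => _ /ltnW.
have mz := scg_z_measurable run t1.
pose D A := S t @^-1` [set A].
have mD A : measurable (D A) by exact: scg_S_measurable run _ _ t1.
have mpsi := measurable_pair_map (history_measurable tT) mz.
pose g A (w : O) : \bar R := (phi A (w, z t w))%:E.
have mg A : measurable_fun setT (g A).
  apply/measurable_EFinP; exact: (measurableT_comp (mphi A) mpsi).
have p0 A w : 0 <= set_prob (x t w) A by exact: set_prob_ge0.
pose avg A (w : O) := ((\int[P]_y (phi A (w, y))%:E) * (set_prob (x t w) A)%:E)%E.
have mavg A : measurable_fun setT (avg A).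
  apply: emeasurable_funM; last first.
    apply/measurable_EFinP; apply: (measurable_fun_ambient tT).
    exact: measurable_set_prob.
  have mF := @measurable_fun_fubini_tonelli_F _ _ _ _ _ P
    (fun u => (phi A u)%:E) _ (fun u => phi0 A u).
  apply: (measurableT_comp (mF _) (measurable_coarsen (history_measurable tT))).
  by apply/measurable_EFinP; exact: mphi.
have avg0 A w : (0 <= avg A w)%E.
  by rewrite mule_ge0 ?lee_fin // integral_ge0 // => y _; rewrite lee_fin.
apply: (@le_trans _ _ (\int[Pr]_w \sum_A avg A w)%E); last first.
  apply: ge0_le_integral => //; first by move=> w _; exact: sume_ge0.
    exact: emeasurable_sum.
  by move=> w _; exact: phih.
rewrite (_ : (\int[Pr]_w (phi (S t w) (w, z t w))%:E)%E =
  (\int[Pr]_w \sum_A avg A w)%E) //.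
transitivity (\int[Pr]_w \sum_A (g A \_ (D A)) w)%E.
  apply: eq_integral => w _; rewrite (bigD1 (S t w)) //= big1 ?adde0.
    by rewrite patchE mem_set.
  by move=> A /eqP AS; rewrite patchE memNset // => /= e; apply: AS.
rewrite ge0_integral_sum//; last 2 first.
- by move=> A; apply/(measurable_restrictT _ (mD A)); apply: measurable_funTS.
- by move=> A w _; rewrite patchE; case: ifP => _ //; rewrite lee_fin.
rewrite ge0_integral_sum//.
apply: eq_bigr => A _; rewrite -integral_mkcond.
have mp : measurable_fun setT (fun w => set_prob (x t w) A).
  by apply: (measurable_fun_ambient tT); exact: measurable_set_prob.
have fresh E B := scg_fresh run (E := E) (B := B) A t1.
have mphiA : measurable_fun setT (fun u => (phi A u)%:E) by apply/measurable_EFinP; exact: mphi.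
have := ge0_integral_fresh (history_measurable tT) mz (mD A) mp (p0 A) fresh mphiA.
by apply => u; rewrite lee_fin.
Qed.

End Run.

(** * The error of the averaged gradient *)

(** Young's inequality, weighted so that the past error keeps the factor [1 - a]. *)
Lemma young_step (R : realFieldType) (a c gt gp dd : R) : 0 < a -> a <= 1 ->
  (gt - gp) ^+ 2 <= c ->
  ((1 - a) * (gt - dd)) ^+ 2 <= (1 - a) * (gp - dd) ^+ 2 + c / a.
Proof.
move=> a0 a1 gc; set y := gp - dd; set b := gt - gp in gc.
have -> : gt - dd = y + b by rewrite /y /b; ring.
apply: (@le_trans _ _ ((1 - a) * y ^+ 2 + b ^+ 2 / a)); last first.
  by rewrite lerD2l ler_wpM2r // invr_ge0 ltW.
rewrite -(ler_pM2l a0) -subr_ge0.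
rewrite (_ : _ - _ = (1 - a) ^+ 2 * (a * y - b) ^+ 2 + a ^+ 3 * (1 - a) * y ^+ 2
   + a * (1 + a * (1 - a)) * b ^+ 2); last by field; rewrite gt_eqF.
have a10 : 0 <= 1 - a by rewrite subr_ge0.
have a0' := ltW a0.
have h : 0 <= a * (1 - a) by rewrite mulr_ge0.
apply: addr_ge0; first (apply: addr_ge0; first by rewrite mulr_ge0 ?sqr_ge0).
  by rewrite mulr_ge0 ?sqr_ge0 // mulr_ge0 // exprn_ge0.
by rewrite mulr_ge0 ?sqr_ge0 // mulr_ge0 // addr_ge0.
Qed.


(** One curvature term and two copies of each error scale; after division by [T]
    both decay at least like [T^(-1/3)]. *)
Lemma total_loss_le (R : realType) (N G D' Q eps : R) T : 1 <= N -> 0 <= G -> 0 < D' -> 0 <= Q ->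
  (0 < T)%N -> (G + 4 * D' * Num.sqrt Q) * Num.sqrt N <= eps * cbrt T ->
  G / T%:R + \sum_(t < T) D' / T%:R * (2 * (Num.sqrt (N * Q) / cbrt (t + 8))) <= eps.
Proof.
move=> N1 G0 D0 Q0 T0 LT.
have Tr : (0 : R) < T%:R by rewrite ltr0n.
have k1 : (1 : R) <= cbrt T by exact: cbrt_ge1.
have k3 : (cbrt T : R) ^+ 3 = T%:R by exact: cbrtX3.
have sN : 1 <= Num.sqrt N by rewrite -[leLHS]sqrtr1 ler_wsqrtr.
have sQ := sqrtr_ge0 Q.
have sum2 := @sum_cbrtV R T.
have -> : \sum_(t < T) D' / T%:R * (2 * (Num.sqrt (N * Q) / cbrt (t + 8))) =
    2 * D' * (Num.sqrt N * Num.sqrt Q) / T%:R * \sum_(t < T) (cbrt (t + 8))^-1.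
  rewrite mulr_sumr; apply: eq_bigr => t _.
  by rewrite sqrtrM ?(le_trans ler01) //; ring.
apply: (@le_trans _ _ (G / T%:R + 2 * D' * (Num.sqrt N * Num.sqrt Q) / T%:R * (2 * cbrt T ^+ 2))).
  rewrite lerD2l ler_wpM2l // divr_ge0 // !mulr_ge0 ?(ltW D0) //.
have k0 : (0 : R) < cbrt T by exact: lt_le_trans k1.
rewrite -k3 -(ler_pM2r k0); apply: le_trans LT; move: (cbrt T) k0 k1 => k k0 k1.
have -> : (G / k ^+ 3 + 2 * D' * (Num.sqrt N * Num.sqrt Q) / k ^+ 3 * (2 * k ^+ 2)) * k
   = G / k ^+ 2 + 4 * D' * Num.sqrt Q * Num.sqrt N.
  by field; rewrite gt_eqF.
rewrite [leRHS]mulrDl lerD2r ler_wpM2l // (le_trans _ sN) // invf_le1 ?exprn_gt0 //.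
exact: exprn_ege1.
Qed.


Section ErrorBound.
Context {R : realType} {n : nat} {dZ : measure_display} {Z : measurableType dZ}
  {dO : measure_display} {O : measurableType dO}.
Variables (I : {set {set 'I_n}}) (ft : {set 'I_n} -> Z -> R) (f : {set 'I_n} -> R)
  (P : probability Z R) (Pr : probability O R) (T : nat)
  (z : nat -> O -> Z) (S : nat -> O -> {set 'I_n}) (x d v : nat -> O -> 'rV[R]_n)
  (m M : R).
Local Notation F := (multilinear f).
Local Notation C := (matroid_polytope R I).
Local Notation s := ((matroid_rank I)%:R : R).
Hypotheses (run : SCG C ft P Pr T z S x d v) (T_gt0 : (0 < T)%N)
  (mft : forall A, measurable_fun setT (ft A)) (ft_ge0 : forall A w, 0 <= ft A w)
  (Eft : (forall A, 'E_P[ft A] = (f A)%:E)%E)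
  (f_ge0 : forall A, 0 <= f A) (f_mono : monotone_setfun f)
  (f_submod : submodular_setfun f) (m_ge0 : 0 <= m)
  (f_single : forall i, f [set i]%SET <= m) (M_ge0 : 0 <= M).
Hypothesis estimate_variance : forall u : 'rV[R]_n, in_cube u ->
  (\sum_(A : {set 'I_n}) (set_prob u A)%:E *
     'E_P[(fun y => enorm (grad_est ft A y - grad F u) ^+ 2)%R] <= (n%:R * M)%:E)%E.

Definition gradient_error (t : nat) (w : O) : R := sqnorm (grad F (x t w) - d t w).

Let x0 w : x 0%N w = 0. Proof. exact: (scg_x0 run). Qed.
Let vP w t : (t < T)%N -> argmax C (d t w) (v t w). Proof. move=> tT; exact: (scg_v run w tT). Qed.
Let xS w t : (t < T)%N -> x t.+1 w = x t w + T%:R^-1 *: v t w.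
Proof. move=> tT; exact: (scg_x run w tT). Qed.

Let xc w t : (t <= T)%N -> in_cube (x t w).
Proof. exact: (iterate_cube T_gt0 (x0 w) (vP w) (xS w)). Qed.

(** An iterate moves by [v t / T], and the coordinates of [v t] sum to at most the
    rank. *)
Lemma grad_drift t i w : (t < T)%N ->
  (grad F (x t.+1 w) ord0 i - grad F (x t w) ord0 i) ^+ 2 <= (m * s / T%:R) ^+ 2.
Proof.
move=> tT; have [Cv _] := vP w tT.
have xx j : x t w ord0 j <= x t.+1 w ord0 j.
  rewrite xS // !mxE lerDl mulr_ge0 ?invr_ge0 ?ler0n //.
  exact: (@dilated_polytope_ge0 _ _ I 1).
have c1 := xc w (ltnW tT); have c2 := xc w tT.
have := grad_lipschitz f_ge0 f_mono f_submod f_single i c1 c2 xx.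
have -> : \sum_j (x t.+1 w ord0 j - x t w ord0 j) = (\sum_j v t w ord0 j) / T%:R.
  by rewrite mulr_suml; apply: eq_bigr => j _; rewrite xS // !mxE; ring.
have := grad_antitone f_submod i c1 c2 xx.
have : m * ((\sum_j v t w ord0 j) / T%:R) <= m * s / T%:R.
  rewrite -mulrA ler_wpM2l // ler_wpM2r ?invr_ge0 //; exact: polytope_sum_le.
move: (m * _) (grad F (x t w) ord0 i) (grad F (x t.+1 w) ord0 i) (m * s / _).
move=> a b c e h1 h2 h3; rewrite -sqrrN opprB ler_pXn2r ?nnegrE //; lra.
Qed.

(** Write the new error as [e - rho (estimate - gradient)], where
    [e = (1 - rho) (gradient - d t.-1)] belongs to the past.  Given the past, the
    second part is centred with variance at most [n M], and [e] is [1 - rho] times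
    the previous error vector plus the drift of the gradient. *)
Lemma gradient_error_step t : (0 < t < T)%N ->
  (\int[Pr]_w (gradient_error t w)%:E <=
   (1 - rho R t)%:E * \int[Pr]_w (gradient_error t.-1 w)%:E +
   (n%:R * ((m * s / T%:R) ^+ 2 / rho R t + rho R t ^+ 2 * M))%:E)%E.
Proof.
move=> tT; have /andP[t0 tltT] := tT.
have predT : (t.-1 < T)%N by rewrite (leq_ltn_trans (leq_pred t)).
set a := rho R t; have a0 : 0 < a := rho_gt0 t; have a1 : a <= 1 := rho_le1 t.
pose e w := (1 - a) *: (grad F (x t w) - d t.-1 w).
pose phi A (u : g_sigma_algebraType (samples z S t.-1) * Z) : R :=
  sqnorm (e u.1 - a *: (grad_est ft A u.2 - grad F (x t u.1))).
have mphi A : measurable_fun setT (phi A).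
  apply: measurable_sqnorm => i.
  have mg : measurable_fun setT ((fun w => grad F (x t w) ord0 i) :
      g_sigma_algebraType (samples z S t.-1) -> R).
    by apply: measurable_grad => j; apply: (measurable_iterate run); exact: ltnW.
  have md : measurable_fun setT ((fun w => d t.-1 w ord0 i) :
      g_sigma_algebraType (samples z S t.-1) -> R).
    exact: (measurable_direction run mft).
  rewrite (_ : (fun u => _) = (fun u : g_sigma_algebraType (samples z S t.-1) * Z =>
    (1 - a) * (grad F (x t u.1) ord0 i - d t.-1 u.1 ord0 i)
     - a * (grad_est ft A u.2 ord0 i - grad F (x t u.1) ord0 i))); last first.
    by apply/funext => u; rewrite /e !mxE.
  have mg1 := measurableT_comp mg (@measurable_fst _ _ _ Z).
  have md1 := measurableT_comp md (@measurable_fst _ _ _ Z).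
  have me2 := measurableT_comp (measurable_grad_est mft A i)
    (@measurable_snd _ _ (g_sigma_algebraType (samples z S t.-1)) Z).
  apply: measurable_funB.
    exact: (measurable_funM (measurable_cst _) (measurable_funB mg1 md1)).
  exact: (measurable_funM (measurable_cst _) (measurable_funB me2 mg1)).
have errE w : gradient_error t w = phi (S t w) (w, z t w).
  rewrite /gradient_error /phi /= (scg_d run) // -/a; congr sqnorm.
  by apply/rowP => i; rewrite /e !mxE; ring.
have mprev : measurable_fun setT (fun w => (gradient_error t.-1 w)%:E).
  by apply/measurable_EFinP; exact: (measurable_error f run mft).
have prev0 w : (0 <= (gradient_error t.-1 w)%:E)%E by rewrite lee_fin sqnorm_ge0.
under eq_integral do rewrite errE.
set B := n%:R * _.
apply: (@le_trans _ _ (\int[Pr]_w ((1 - a)%:E * (gradient_error t.-1 w)%:E + B%:E))%E).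
  apply: (le_integral_sample run tT) => //.
  - by move=> w; apply: xc; exact: ltnW.
  - by move=> A u; exact: sqnorm_ge0.
  - by apply: emeasurable_funD => //; exact: measurable_funeM.
  move=> w; have xtc := xc w (ltnW tltT).
  apply: (le_trans (conditional_variance mft ft_ge0 Eft (e w) a xtc (estimate_variance xtc))).
  rewrite -EFinM -EFinD lee_fin /B.
  have -> : (n%:R * ((m * s / T%:R) ^+ 2 / a + a ^+ 2 * M) =
     \sum_(i < n) (m * s / T%:R) ^+ 2 / a + a ^+ 2 * (n%:R * M)).
    by rewrite sumr_const card_ord -mulr_natl; ring.
  rewrite addrA lerD2r /gradient_error /sqnorm mulr_sumr -big_split /=.
  apply: ler_sum => i _; rewrite /e !mxE.
  have := grad_drift i w predT; rewrite prednK // !mxE.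
  exact: young_step.
have B0 : 0 <= B.
  by rewrite /B mulr_ge0 // addr_ge0 ?divr_ge0 ?mulr_ge0 ?sqr_ge0 // ltW.
rewrite ge0_integralD//; last 2 first.
- by move=> w _; apply: mule_ge0; rewrite ?lee_fin ?subr_ge0 ?sqnorm_ge0.
- exact: measurable_funeM.
by rewrite ge0_integralZl ?lee_fin ?subr_ge0 // integral_probability_cst.
Qed.

(** Induction on [t]; the first condition on [Q] starts it, as [d 0 = 0], and the
    second one makes [error_recursion] applicable. *)
Lemma gradient_error_bound (Q : R) t : (t < T)%N ->
  4 * m ^+ 2 <= Q -> 6 * (m * s) ^+ 2 + 16 * M <= 3 * Q ->
  (\int[Pr]_w (gradient_error t w)%:E <= (n%:R * (Q / cbrt (t + 8) ^+ 2))%:E)%E.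
Proof.
move=> tT Q1 Q2; elim: t tT => [|t IH] tT.
  apply: (@le_trans _ _ (\int[Pr]_w (n%:R * m ^+ 2)%:E)%E).
    apply: ge0_le_integral => //.
    - by move=> w _; rewrite lee_fin sqnorm_ge0.
    - by apply/measurable_EFinP; exact: (measurable_error f run mft).
    move=> w _; rewrite lee_fin /gradient_error x0 (scg_d0 run) subr0.
    have -> : n%:R * m ^+ 2 = \sum_(i < n) m ^+ 2 by rewrite sumr_const card_ord mulr_natl.
    have c0 : in_cube (0 : 'rV[R]_n) by move=> j; rewrite mxE lexx ler01.
    apply: ler_sum => i _; rewrite ler_pXn2r ?nnegrE //.
      exact: (grad_le f_ge0 f_submod f_single).
    exact: (grad_ge0 f_mono).
  rewrite integral_probability_cst lee_fin ler_wpM2l // ler_pdivlMr; last first.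
    by rewrite exprn_gt0 // (lt_le_trans ltr01) // cbrt_ge1.
  apply: le_trans Q1; rewrite mulrC ler_wpM2r ?sqr_ge0 //.
  have c8 : (cbrt (0 + 8) : R) <= 2.
    by rewrite -(@ler_pXn2r _ 3) ?nnegrE ?cbrt_ge0 // cbrtX3 -natrX ler_nat.
  have := cbrt_ge0 (R := R) (0 + 8); nra.
have t1 : (0 < t.+1 < T)%N by [].
apply: (le_trans (gradient_error_step t1)).
apply: (@le_trans _ _ ((1 - rho R t.+1)%:E * (n%:R * (Q / cbrt (t + 8) ^+ 2))%:E +
   (n%:R * ((m * s / T%:R) ^+ 2 / rho R t.+1 + rho R t.+1 ^+ 2 * M))%:E)%E).
  by apply: leeD2r; apply: lee_wpmul2l; rewrite ?lee_fin ?subr_ge0 ?rho_le1 // IH // ltnW.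
rewrite -EFinM -EFinD lee_fin mulrCA -mulrDr ler_wpM2l // addrA.
exact: error_recursion.
Qed.

Variables (D' OPT : R).
Hypotheses (D'_gt0 : 0 < D') (C_bound : forall u, C u -> sqnorm u <= D' ^+ 2)
  (OPT_max : maximum_of [set F u | u in C] OPT).

(** Integrate [iterate_gap] with the scales [c t] equal to the square roots of the
    bounds on the expected errors: then each term [error / c t + c t] has
    expectation at most [2 c t]. *)
Lemma expected_gap (Q : R) : (0 < n)%N -> 0 < Q ->
  4 * m ^+ 2 <= Q -> 6 * (m * s) ^+ 2 + 16 * M <= 3 * Q ->
  (((1 - (expR 1)^-1) * OPT)%:E <= 'E_Pr[fun w => F (x T w)] +
   (m * s ^+ 2 / T%:R +
    \sum_(t < T) D' / T%:R * (2 * (Num.sqrt (n%:R * Q) / cbrt (t + 8))))%:E)%E.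
Proof.
move=> n0 Q0 Q1 Q2.
pose c t : R := Num.sqrt (n%:R * Q) / cbrt (t + 8).
have cbrt0 t : 0 < (cbrt (t + 8) : R) by rewrite (lt_le_trans ltr01) // cbrt_ge1 // addnS.
have c0 t : 0 < c t by rewrite divr_gt0 // sqrtr_gt0 mulr_gt0 // ltr0n.
have c2 t : n%:R * (Q / cbrt (t + 8) ^+ 2) = c t ^+ 2.
  by rewrite expr_div_n sqr_sqrtr ?mulrA // mulr_ge0 // ltW.
have TV : 0 < D' / T%:R by rewrite divr_gt0 // ltr0n.
pose B := m * s ^+ 2 / T%:R + \sum_(t < T) D' / T%:R * c t.
have B0 : 0 <= B.
  rewrite addr_ge0 // ?divr_ge0 ?mulr_ge0 ?sqr_ge0 //; apply: sumr_ge0 => t _.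
  by rewrite mulr_ge0 // ltW.
pose err t w : R := (D' / T%:R / c t) * gradient_error t w.
have err0 t w : 0 <= err t w.
  by rewrite mulr_ge0 ?sqnorm_ge0 // divr_ge0 // ltW.
have merr (t : 'I_T) : measurable_fun setT (err t).
  by apply: measurable_funM => //; exact: (measurable_error f run mft).
have cubeC u : C u -> in_cube u.
  by move=> Cu; apply: (@dilated_polytope_cube _ _ I 1).
have Fge0 u : in_cube u -> 0 <= F u.
  by move=> uc; rewrite -[leLHS](multilinear_cst 0 u) ler_multilinear.
have OPT0 : 0 <= OPT.
  by have [[xs Cxs <-] _] := OPT_max; apply: Fge0; exact: cubeC.
have xTc w : in_cube (x T w).
  exact/cubeC/(iterate_feasible T_gt0 (scg_x0 run w)
    (fun t tT => scg_v run w tT) (fun t tT => scg_x run w tT)).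
have mF : measurable_fun setT (fun w => F (x T w)).
  exact: (measurable_final_value f run T_gt0).
have pathwise w : (1 - (expR 1)^-1) * OPT <= F (x T w) + B + \sum_(t < T) err t w.
  have := iterate_gap f_ge0 f_mono f_submod m_ge0 f_single D'_gt0 C_bound OPT_max
    T_gt0 (scg_x0 run w) (fun t tT => scg_v run w tT) (fun t tT => scg_x run w tT) c0.
  move=> /le_trans -> //; rewrite /B -!addrA lerD2l lerD2l -big_split /= le_eqVlt.
  apply/orP; left; apply/eqP; apply: eq_bigr => t _.
  by rewrite /err /gradient_error; field; rewrite gt_eqF //= gt_eqF // ltr0n.
apply: (@le_trans _ _ (\int[Pr]_w (((F (x T w))%:E + B%:E) + \sum_(t < T) (err t w)%:E))%E).
  rewrite -(integral_probability_cst Pr); apply: ge0_le_integral => //.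
  - move=> w _; rewrite lee_fin mulr_ge0 // subr_ge0 invf_le1 ?expR_gt0 //.
    by rewrite -[leLHS]expR0 ler_expR.
  - apply: emeasurable_funD; last by apply: emeasurable_sum => t; exact/measurable_EFinP.
    by apply: emeasurable_funD => //; exact/measurable_EFinP.
  - by move=> w _; rewrite sumEFin -!EFinD lee_fin; exact: pathwise.
rewrite ge0_integralD//; last 4 first.
- by move=> w _; rewrite -EFinD lee_fin addr_ge0 // Fge0.
- by apply: emeasurable_funD => //; exact/measurable_EFinP.
- by move=> w _; apply: sume_ge0 => t _; rewrite lee_fin.
- by apply: emeasurable_sum => t; exact/measurable_EFinP.
rewrite ge0_integralD//; last 2 first.
- by move=> w _; rewrite lee_fin Fge0.
- exact/measurable_EFinP.
rewrite integral_probability_cst ge0_integral_sum//; last 2 first.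
- by move=> t; exact/measurable_EFinP.
- by move=> t w _; rewrite lee_fin.
have -> : ('E_Pr[fun w => F (x T w)] = \int[Pr]_w (F (x T w))%:E)%E by rewrite unlock.
rewrite -addeA; apply: leeD2l.
have -> : \sum_(t < T) D' / T%:R * (2 * (Num.sqrt (n%:R * Q) / cbrt (t + 8))) =
   \sum_(t < T) D' / T%:R * c t + \sum_(t < T) D' / T%:R * c t.
  by rewrite -big_split /=; apply: eq_bigr => t _; rewrite /c; ring.
rewrite addrA -/B [leRHS]EFinD; apply: leeD2l; rewrite -sumEFin; apply: lee_sum => t _.
have ct := c0 t.
under eq_integral do rewrite EFinM.
rewrite ge0_integralZl//; last 3 first.
- by apply/measurable_EFinP; exact: (measurable_error f run mft).
- by move=> w _; rewrite lee_fin sqnorm_ge0.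
- by rewrite lee_fin divr_ge0 // ltW.
have -> : D' / T%:R * c t = D' / T%:R / c t * (c t ^+ 2).
  by field; rewrite gt_eqF //= gt_eqF // ltr0n.
rewrite [leRHS]EFinM -c2; apply: lee_wpmul2l; first by rewrite lee_fin divr_ge0 // ltW.
exact: gradient_error_bound.
Qed.

End ErrorBound.

(** * Counting iterations and evaluations *)

Section Counting.
Context {R : realType}.

Lemma scg_evalsE (n : nat) dZ (Z : measurableType dZ) dO (O : measurableType dO)
    (ft : {set 'I_n} -> Z -> R) T (z : nat -> O -> Z) (S : nat -> O -> {set 'I_n}) w :
  scg_evals ft T z S w = (T.-1 * (n * 2))%N.
Proof.
rewrite /scg_evals (eq_bigr (fun=> n * 2)%N); last first.
  by move=> t _; rewrite /grad_cost (eq_bigr (fun=> 2%N)) // sum_nat_const card_ord.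
by rewrite sum_nat_const_nat subn1.
Qed.

Lemma powR_three_halves (n : nat) : n%:R `^ (3 / 2) = Num.sqrt (n%:R : R) ^+ 3.
Proof.
rewrite -powR12_sqrt // -powR_mulrn ?powR_ge0 // -powRrM; congr (_ `^ _).
by field.
Qed.

Lemma powR_five_halves (n : nat) : (0 < n)%N ->
  n%:R `^ (5 / 2) = n%:R * (n%:R : R) `^ (3 / 2).
Proof.
move=> n0; rewrite -[X in _ = X * _]powRr1 // -powRD; last first.
  by rewrite pnatr_eq0 -lt0n n0 implybT.
by congr (_ `^ _); field.
Qed.

(** Take [L^3 n^(3/2) / eps^3] iterations, rounded up; since [eps < c], rounding
    costs at most [c^3 n^(3/2) / eps^3]. *)
Lemma iteration_count (L c eps : R) (n : nat) : 0 <= L -> 0 < eps -> eps < c -> (0 < n)%N ->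
  exists T : nat, [/\ (0 < T)%N,
    L * Num.sqrt n%:R <= eps * cbrt T
    & T%:R <= (L ^+ 3 + c ^+ 3) * (n%:R `^ (3 / 2) / eps ^+ 3)].
Proof.
move=> L0 e0 ec n0; set X := n%:R `^ (3 / 2) / eps ^+ 3.
have n1 : 1 <= Num.sqrt (n%:R : R) by rewrite -[leLHS]sqrtr1 ler_wsqrtr // ler1n.
have X0 : 0 <= X by rewrite divr_ge0 ?powR_ge0 // exprn_ge0 // ltW.
exists (Num.truncn (L ^+ 3 * X)).+1; split => //.
- rewrite mulrC -ler_pdivrMl // mulrC; apply: cbrt_ge.
  apply: ltW; apply: le_lt_trans (truncnS_gt _).
  rewrite /X powR_three_halves -subr_ge0 le_eqVlt; apply/orP; left; apply/eqP.
  by field; rewrite gt_eqF.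
- have LX : 0 <= L ^+ 3 * X by rewrite mulr_ge0 // exprn_ge0.
  have tr : (Num.truncn (L ^+ 3 * X))%:R <= L ^+ 3 * X by rewrite truncn_le.
  rewrite -natr1 mulrDl lerD //.
  rewrite /X mulrA ler_pdivlMr ?exprn_gt0 // mul1r powR_three_halves.
  rewrite -[leLHS]mulr1 ler_pM ?exprn_ge0 ?exprn_ege1 //; first exact: ltW.
  by rewrite ler_pXn2r ?nnegrE ?(ltW e0) ?(ltW ec) // ltW // (lt_trans e0).
Qed.

End Counting.

Theorem corollary12 (R : realType) (r : nat) (D m M : R) :
  exists K : R, forall (n : nat) (eps : R), (0 < n)%N -> 0 < eps ->
  exists T : nat,
    T%:R <= K * (n%:R `^ (3 / 2) / eps ^+ 3) /\
    forall (dZ : measure_display) (Z : measurableType dZ)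
      (P : probability Z R)
      (ft : {set 'I_n} -> Z -> R) (f : {set 'I_n} -> R)
      (I : {set {set 'I_n}}) (OPT : R),
      (forall A, measurable_fun setT (ft A)) ->
      (forall A z, 0 <= ft A z) ->
      (forall A, 'E_P[ft A] = (f A)%:E)%E ->
      monotone_setfun f ->
      submodular_setfun f ->
      matroid I ->
      matroid_rank I = r ->
      (forall x, matroid_polytope R I x -> enorm x <= D) ->
      maximum_of [set f [set i]%SET | i in [set: 'I_n]] m ->
      M%:E = (\big[maxe/0]_(j < n) 'E_P[(fun z => ft [set j]%SET z ^+ 2)%R])%E ->
      (forall x : 'rV[R]_n, in_cube x ->
        (\sum_(A : {set 'I_n}) (set_prob x A)%:E *
           'E_P[(fun z =>
             enorm (grad_est ft A z - grad (multilinear f) x) ^+ 2)%R]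
         <= (n%:R * M)%:E)%E) ->
      maximum_of [set multilinear f x | x in matroid_polytope R I] OPT ->
      forall (dO : measure_display) (O : measurableType dO)
        (Pr : probability O R)
        (z : nat -> O -> Z) (S : nat -> O -> {set 'I_n})
        (x d v : nat -> O -> 'rV[R]_n),
        SCG (matroid_polytope R I) ft P Pr T z S x d v ->
        [/\ forall w, matroid_polytope R I (x T w),
            (((1 - (expR 1)^-1) * OPT - eps)%:E
               <= 'E_Pr[fun w => multilinear f (x T w)])%E
          & forall w, (scg_evals ft T z S w)%:R
               <= K * (n%:R `^ (5 / 2) / eps ^+ 3)].
Proof.
(* The constants are fixed before any hypothesis on [m], [M] and [D] is known;
   absolute values and the added units make them nonnegative or positive. *)
pose a := `|m|; pose s : R := r%:R; pose D' := `|D| + 1.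
pose Q := 6 * (a * s) ^+ 2 + 16 * `|M| + 4 * a ^+ 2 + 1.
pose L := a * s ^+ 2 + 4 * D' * Num.sqrt Q; pose c := a * (s + 1).
have a0 : 0 <= a := normr_ge0 m.
have s0 : 0 <= s by rewrite /s.
have D'0 : 0 < D' by rewrite /D' ltr_wpDl.
have as0 : 0 <= a * s ^+ 2 by rewrite mulr_ge0 ?sqr_ge0.
have sq1 := sqr_ge0 (a * s); have sq2 := sqr_ge0 a; have absM := normr_ge0 M.
have Q0 : 0 < Q by rewrite /Q; lra.
have L0 : 0 <= L by rewrite addr_ge0 // !mulr_ge0 ?sqrtr_ge0 // ltW.
have c0 : 0 <= c by rewrite mulr_ge0 // addr_ge0.
(* The factor 2 counts the two evaluations per coordinate of an estimate. *)
exists (2 * (L ^+ 3 + c ^+ 3)) => n eps n0 eps0.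
set X := n%:R `^ (3 / 2) / eps ^+ 3.
have X0 : 0 <= X by rewrite divr_ge0 ?powR_ge0 // exprn_ge0 // ltW.
have K0 : 0 <= L ^+ 3 + c ^+ 3 by rewrite addr_ge0 ?exprn_ge0.
have e01 : 0 <= 1 - (expR (1 : R))^-1 <= 1.
  rewrite subr_ge0 invf_le1 ?expR_gt0 // gerBl invr_ge0 expR_ge0 andbT.
  by rewrite -[leLHS]expR0 ler_expR.
have common dZ (Z : measurableType dZ) (P : probability Z R)
    (ft : {set 'I_n} -> Z -> R) (f : {set 'I_n} -> R) (I : {set {set 'I_n}}) OPT :
    (forall A z, 0 <= ft A z) -> (forall A, 'E_P[ft A] = (f A)%:E)%E ->
    monotone_setfun f -> submodular_setfun f -> matroid_rank I = r ->
    maximum_of [set f [set i]%SET | i in [set: 'I_n]] m ->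
    maximum_of [set multilinear f x | x in matroid_polytope R I] OPT ->
    [/\ forall A, 0 <= f A, forall i, f [set i]%SET <= a, 0 <= OPT & OPT <= c].
  move=> ft0 Eft fm fs Ir [[i0 _ fi0] mub] [[xs Cxs Fxs] _].
  have f0 A : 0 <= f A.
    by rewrite -lee_fin -Eft; apply: expectation_ge0 => w; exact: ft0.
  have m0 : 0 <= m by rewrite -fi0.
  have fi i : f [set i]%SET <= a.
    by rewrite /a ger0_norm //; apply: mub; exists i.
  have xc : in_cube xs by exact: (@dilated_polytope_cube _ _ I 1).
  split => //; rewrite -Fxs.
    by rewrite -[leLHS](multilinear_cst 0 xs) ler_multilinear.
  apply: multilinear_le => //.
  by rewrite /s -Ir; exact: polytope_sum_le.
(* As [OPT <= c], a tolerance of at least [c] is met without any iteration; the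
   required bound on [T] leaves no other choice when [eps] is large. *)
have [ceps|epsc] := leP c eps.
  exists 0%N; split; first by apply: mulr_ge0 => //; rewrite mulr_ge0.
  move=> dZ Z P ft f I OPT mft ft0 Eft fm fs mI Ir CD fmax _ _ OPTmax dO O Pr z S x d v run.
  have [f0 _ OPT0 OPTc] := common _ _ _ _ _ _ _ ft0 Eft fm fs Ir fmax OPTmax.
  have x0 w : x 0%N w = 0 by exact: (scg_x0 run).
  split.
  - by move=> w; rewrite x0; exact: polytope0.
  - under eq_fun do rewrite x0 multilinear0.
    rewrite expectation_cst lee_fin; apply: le_trans (f0 _).
    have /andP[e0 e1] := e01; nra.
  - move=> w; rewrite scg_evalsE mul0n; apply: mulr_ge0; first by rewrite mulr_ge0.
    by rewrite divr_ge0 ?powR_ge0 ?exprn_ge0 // ltW.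
have [T [T0 LT TX]] := iteration_count L0 eps0 epsc n0.
exists T; split; first by rewrite -/X in TX; nra.
move=> dZ Z P ft f I OPT mft ft0 Eft fm fs mI Ir CD fmax _ var OPTmax dO O Pr z S x d v run.
have [f0 fi OPT0 OPTc] := common _ _ _ _ _ _ _ ft0 Eft fm fs Ir fmax OPTmax.
split.
- move=> w; exact: (iterate_feasible T0 (scg_x0 run w)
    (fun t tT => scg_v run w tT) (fun t tT => scg_x run w tT)).
- have var' u : in_cube u -> (\sum_(A : {set 'I_n}) (set_prob u A)%:E *
     'E_P[(fun y => enorm (grad_est ft A y - grad (multilinear f) u) ^+ 2)%R]
      <= (n%:R * `|M|)%:E)%E.
    move=> uc; apply: le_trans (var u uc) _.
    by rewrite lee_fin ler_wpM2l // ler_norm.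
  have Cb u : matroid_polytope R I u -> sqnorm u <= D' ^+ 2.
    move=> Cu; rewrite -enormX2 ler_pXn2r ?nnegrE ?sqrtr_ge0 ?(ltW D'0) //.
    apply: le_trans (CD u Cu) _; rewrite /D'; have := ler_norm D; lra.
  have Q1 : 4 * a ^+ 2 <= Q by rewrite /Q; lra.
  have Q2 : 6 * (a * (matroid_rank I)%:R) ^+ 2 + 16 * `|M| <= 3 * Q.
    by rewrite Ir -/s /Q; lra.
  have := expected_gap run T0 mft ft0 Eft f0 fm fs a0 fi absM var' D'0 Cb OPTmax n0 Q0 Q1 Q2.
  rewrite Ir -/s EFinB leeBlDr // => /le_trans; apply.
  apply: leeD2l; rewrite lee_fin.
  apply: total_loss_le => //; first by rewrite ler1n.
  exact: ltW.
- move=> w; rewrite scg_evalsE powR_five_halves // natrM natrM.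
  rewrite (_ : n%:R * _ / _ = n%:R * X); last by rewrite /X mulrA.
  have T1 : T.-1%:R <= T%:R :> R by rewrite ler_nat leq_pred.
  rewrite -/X in TX.
  have := le_trans T1 TX; have : 0 <= n%:R :> R by []; nra.
Qed.
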